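(* Let $n\ge2$ and let $\Omega\subset\mathbb R^n$ be a domain of diameter $R$ that is star-shaped with respect to a ball of radius $\rho$. Let $C_{BA,0}>0$ be a constant such that for every $f\in L^2_0(\Omega)$ there exists $\mathbf u\in[H^1_0(\Omega)]^n$ with $\nabla\cdot\mathbf u=f$ and $|\mathbf u|_{1,\Omega}\le C_{BA,0}\|f\|_{0,\Omega}$. Define $$ C_{NL,0}:=\sup_{f\in L^2(\Omega)}\frac{\|f-\Pi^0f\|_{0,\Omega}}{\|\nabla f\|_{-1,\Omega}},\qquad \beta_0:=\inf_{f\in L^2_0(\Omega)}\ \sup_{\mathbf u\in[H^1_0(\Omega)]^n}\frac{(\nabla\cdot\mathbf u,f)_{0,\Omega}}{|\mathbf u|_{1,\Omega}\,\|f\|_{0,\Omega}}, $$ where the first supremum is over non-constant $f$ and the others are over nonzero elements. Then $$ C_{BA,0}\ \ge\ C_{NL,0}=\beta_0^{-1}. $$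
   Context: Star-shaped with respect to a ball $B$: for every $x\in\Omega$, $y\in B$ the segment joining $x$ and $y$ lies in $\Omega$. $(\cdot,\cdot)_{0,\Omega}$, $\|\cdot\|_{0,\Omega}$ are the $L^2(\Omega)$ inner product and norm; $|\cdot|_{1,\Omega}$ is the $H^1(\Omega)$ seminorm (the $L^2$ norm of the gradient). $H^1_0(\Omega)$ is the closure of $\mathcal C_0^\infty(\Omega)$ in $H^1(\Omega)$; $L^2_0(\Omega)$ is the space of zero-average $L^2(\Omega)$ functions; $\Pi^0f$ is the average of $f$ over $\Omega$. $H^{-1}(\Omega)=[H^1_0(\Omega)]^*$ with $\|u\|_{-1,\Omega}:=\sup_{v\in H^1_0(\Omega)\setminus\{0\}}\langle u,v\rangle/|v|_{1,\Omega}$, and similarly for vector-valued distributions with test fields in $[H^1_0(\Omega)]^n$. $\nabla f$ is the distributional gradient. *)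

(* Defs.v *)
From HB Require Import structures.
From mathcomp Require Import all_boot all_order all_algebra.
From mathcomp Require Import all_classical all_reals all_analysis.
Import Order.TTheory GRing.Theory Num.Theory.
Import numFieldNormedType.Exports.
Set Implicit Arguments. Unset Strict Implicit. Unset Printing Implicit Defensive.
Local Open Scope classical_set_scope.
Local Open Scope ring_scope.

(* 'rV[R]_n stands for R^n. It carries the product sigma-algebra, i.e. the one
   generated by the coordinates, which is the Borel one (see
   [open_measurable_rV]). *)
Fact rV_display : measure_display. Proof. exact: default_measure_display. Qed.

Section measurable_rV.
Context {R : realType} {n : nat}.

Definition rV_coord (i : 'I_n) (x : 'rV[R]_n) : measurableTypeR R := x ord0 i.

Let rV_set0 : g_sigma_preimage rV_coord set0.
Proof. exact: sigma_algebra0. Qed.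

Let rV_setC A : g_sigma_preimage rV_coord A ->
  g_sigma_preimage rV_coord (~` A).
Proof. exact: sigma_algebraC. Qed.

Let rV_bigcup (F : _^nat) : (forall i, g_sigma_preimage rV_coord (F i)) ->
  g_sigma_preimage rV_coord (\bigcup_i (F i)).
Proof. exact: sigma_algebra_bigcup. Qed.

HB.instance Definition _ := @isMeasurable.Build rV_display 'rV[R]_n
  (g_sigma_preimage rV_coord) rV_set0 rV_setC rV_bigcup.

Lemma measurable_rV_coord (i : 'I_n) : measurable_fun [set: 'rV[R]_n] (rV_coord i).
Proof.
move=> _ Y mY; rewrite setTI; apply: sub_sigma_algebra => /=.
rewrite -bigcup_seq/=; exists i => /=; first by rewrite mem_index_enum.
by exists Y => //; rewrite setTI.
Qed.

Lemma measurable_fun_rV d (T : measurableType d) (f : T -> 'rV[R]_n) :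
  (forall i, measurable_fun [set: T] (rV_coord i \o f)) ->
  measurable_fun [set: T] f.
Proof.
move=> mf _ A mA.
have : preimage_set_system setT f (g_sigma_preimage rV_coord) (setT `&` f @^-1` A).
  by exists A.
rewrite -g_sigma_preimage_comp; apply: smallest_sub.
  exact: sigma_algebra_measurable.
move=> B; rewrite -bigcup_seq /= => -[i _ [C mC <-]].
exact: mf.
Qed.

End measurable_rV.

Section lebesgue_rV.
Context {R : realType}.

(* Lebesgue measure on R^n: the n-fold product of the one-dimensional one,
   transported along R * R^n -> R^(n+1); [lebesgue_rV_box] characterizes it. *)
Definition consrV {n} (p : measurableTypeR R * 'rV[R]_n) : 'rV[R]_n.+1 :=
  row_mx (p.1)%:M p.2.

Lemma consrV0 n (p : measurableTypeR R * 'rV[R]_n) : consrV p ord0 ord0 = p.1.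
Proof.
have pE : (p.1%:M : 'M[R]_1) ord0 ord0 = p.1 by rewrite mxE.
rewrite -[RHS]pE -(@row_mxEl R 1 1 n p.1%:M p.2 ord0 ord0).
by congr (row_mx _ _ _ _); exact: val_inj.
Qed.

Lemma consrVS n (p : measurableTypeR R * 'rV[R]_n) (i : 'I_n) :
  consrV p ord0 (lift ord0 i) = p.2 ord0 i.
Proof.
rewrite -[RHS](@row_mxEr R 1 1 n p.1%:M p.2).
by congr (row_mx _ _ _ _); exact: val_inj.
Qed.

Lemma measurable_consrV n : measurable_fun setT (@consrV n).
Proof.
apply: measurable_fun_rV => i; case: (unliftP ord0 i) => [j ->|->].
  rewrite (_ : _ \o _ = rV_coord j \o snd).
    exact: measurableT_comp (measurable_rV_coord j) measurable_snd.
  by apply/funext => p; rewrite /= /rV_coord consrVS.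
rewrite (_ : _ \o _ = fst); first exact: measurable_fst.
by apply/funext => p; rewrite /= /rV_coord consrV0.
Qed.

Section step.
Context {n : nat} (mu : {sigma_finite_measure set 'rV[R]_n -> \bar R}).

Definition lebesgue_rV_step : set 'rV[R]_n.+1 -> \bar R :=
  pushforward (lebesgue_measure \x mu)%E consrV.

Let step0 : lebesgue_rV_step set0 = 0%E.
Proof. by rewrite /lebesgue_rV_step /pushforward preimage_set0 measure0. Qed.

Let step_ge0 A : (0 <= lebesgue_rV_step A)%E.
Proof. by rewrite /lebesgue_rV_step /pushforward integral_ge0. Qed.

Let step_sigma_additive : semi_sigma_additive lebesgue_rV_step.
Proof.
have mc := @measurable_consrV n.
exact: measure_semi_sigma_additive.
Qed.

HB.instance Definition _ := isMeasure.Build _ _ _ lebesgue_rV_step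
  step0 step_ge0 step_sigma_additive.

Let sigma_finite_step : sigma_finite setT lebesgue_rV_step.
Proof.
have /sigma_finiteP[F [TF ndF Foo]] := sigma_finiteT (@lebesgue_measure R).
have /sigma_finiteP[G [TG ndG Goo]] := sigma_finiteT mu.
pose g (x : 'rV[R]_n.+1) : measurableTypeR R * 'rV[R]_n :=
  (x ord0 ord0, \row_i x ord0 (lift ord0 i)).
have gK : cancel g consrV.
  move=> x; apply/rowP => i; rewrite -[0]/(@ord0 0).
  case: (unliftP ord0 i) => [j ->|->]; last by rewrite consrV0.
  by rewrite consrVS mxE.
have Kg : cancel consrV g.
  move=> [a v]; rewrite /g consrV0; congr (_, _).
  by apply/rowP => i; rewrite mxE consrVS.
have mg : measurable_fun setT g.
  apply/measurable_fun_pairP; split.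
    exact: (measurable_rV_coord ord0).
  apply: measurable_fun_rV => i.
  rewrite (_ : _ \o _ = rV_coord (lift ord0 i)).
    exact: measurable_rV_coord.
  by apply/funext => x; rewrite /= /rV_coord mxE.
have gFGE k : consrV @^-1` (g @^-1` (F k `*` G k)) = F k `*` G k.
  by rewrite -comp_preimage (_ : g \o consrV = id)//; apply/funext.
exists (fun k => g @^-1` (F k `*` G k)).
  rewrite -preimage_bigcup (_ : \bigcup_k _ = setT) ?preimage_setT//.
  apply/seteqP; split=> // -[x y] _.
  have [i _ Fx] : (\bigcup_i F i) x by rewrite -TF.
  have [j _ Gy] : (\bigcup_i G i) y by rewrite -TG.
  exists (maxn i j) => //; split => /=.
    by move: x Fx {Gy}; exact/subsetPset/ndF/leq_maxl.
  by move: y Gy; exact/subsetPset/ndG/leq_maxr.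
move=> k; have [mF Fk] := Foo k; have [mG Gk] := Goo k; split.
  by rewrite -[X in measurable X]setTI; apply: mg => //; exact: measurableX.
rewrite /lebesgue_rV_step /pushforward gFGE product_measure1E//.
by rewrite lte_mul_pinfty// ge0_fin_numE.
Qed.

HB.instance Definition _ :=
  Measure_isSigmaFinite.Build _ _ _ lebesgue_rV_step sigma_finite_step.

End step.

Fixpoint lebesgue_rV_rec n : {sigma_finite_measure set 'rV[R]_n -> \bar R} :=
  if n is n'.+1 then lebesgue_rV_step (lebesgue_rV_rec n') else \d_(0 : 'rV[R]_0).

Definition lebesgue_rV {n} : {sigma_finite_measure set 'rV[R]_n -> \bar R} :=
  lebesgue_rV_rec n.

Lemma lebesgue_rV_box n (A : 'I_n -> set (measurableTypeR R)) :
  (forall i, measurable (A i)) ->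
  lebesgue_rV [set x : 'rV[R]_n | forall i, A i (x ord0 i)] =
  (\prod_(i < n) lebesgue_measure (A i))%E.
Proof.
rewrite /lebesgue_rV; elim: n A => [|n IH] A mA /=.
  rewrite big_ord0 /= diracE mem_set// => -[].
  by [].
rewrite /lebesgue_rV_step /pushforward.
pose B := [set x : 'rV[R]_n | forall i, A (lift ord0 i) (x ord0 i)].
rewrite (_ : _ @^-1` _ = A ord0 `*` B); last first.
  apply/seteqP; split=> [p /= Ap|p /= [p0 pS] i].
    split; first by have := Ap ord0; rewrite consrV0.
    by move=> i; have := Ap (lift ord0 i); rewrite consrVS.
  by case: (unliftP ord0 i) => [j ->|->]; rewrite ?consrV0// consrVS.
rewrite product_measure1E//; last first.
  rewrite (_ : B = \bigcap_(i in [set: 'I_n]) (rV_coord i @^-1` A (lift ord0 i))).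
    apply: fin_bigcap_measurable => //.
    move=> i _; rewrite -[X in measurable X]setTI.
    by apply: measurable_rV_coord => //; exact: mA.
  by apply/seteqP; split=> [x Bx i _|x Bx i]; [exact: Bx|exact: (Bx i)].
by rewrite big_ord_recl; congr (_ * _)%E; exact: IH.
Qed.

End lebesgue_rV.

Lemma open_measurable_rV (R : realType) n (U : set 'rV[R]_n) :
  open U -> measurable U.
Proof.
move=> oU.
pose q (r : 'rV[rat]_n) : 'rV[R]_n := \row_i ratr (r ord0 i).
pose D := [set p : 'rV[rat]_n * nat | ball (q p.1) (p.2.+1%:R^-1) `<=` U].
have -> : U = \bigcup_(p in D) ball (q p.1) (p.2.+1%:R^-1).
  apply/seteqP; split=> [x Ux|x [p Dp px]]; last exact: Dp px.
  have /nbhs_ballP[e /= e0 xU] := open_nbhs_nbhs (conj oU Ux).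
  have [k ke] : exists k, k.+1%:R^-1 < e / 2 :> R.
    have [k _ /(_ k)] := near_infty_natSinv_lt (PosNum (divr_gt0 e0 (ltr0Sn R 1))).
    by move=> /(_ (leqnn _)) ?; exists k.
  have k0 : 0 < k.+1%:R^-1 :> R by rewrite invr_gt0.
  have /choice[f fP] : forall i, exists r : rat, `|x ord0 i - ratr r| < k.+1%:R^-1.
    move=> i; have : x ord0 i - k.+1%:R^-1 < x ord0 i + k.+1%:R^-1.
      by rewrite ltrBlDr -addrA ltrDl addr_gt0.
    move=> /rat_in_itvoo[r]; rewrite in_itv/= => rP.
    by exists r; rewrite distrC ltr_distl.
  have bx : ball (q (\row_i f i)) k.+1%:R^-1 x.
    split=> // i j; rewrite (ord1 i) /q !mxE.
    by rewrite /ball/= distrC; exact: fP.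
  exists (\row_i f i, k) => //= y qy; apply: xU.
  apply: (@le_ball _ _ _ (k.+1%:R^-1 + k.+1%:R^-1)).
    by rewrite (splitr e) lerD// ltW.
  by apply: ball_triangle qy; exact: ball_sym.
rewrite bigcup_mkcond; apply: countable_bigcupT_measurable => //.
move=> [r k]; case: ifPn => // _.
have k0 : 0 < k.+1%:R^-1 :> R by rewrite invr_gt0.
rewrite (_ : ball _ _ = \bigcap_(i in [set: 'I_n])
    (rV_coord i @^-1` ball (q r ord0 i) k.+1%:R^-1)).
  apply: fin_bigcap_measurable => [|i _]; first exact: finite_finset.
  rewrite -[X in measurable X]setTI; apply: (measurable_rV_coord i measurableT).
  by apply: (@measurable_realfun.open_measurable R); exact: ball_open.
apply/seteqP; split=> [x [_ qx] i _|x qx]; first exact: qx.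
by split=> // i j; rewrite (ord1 i); exact: qx.
Qed.

Section sobolev.
Context {R : realType} {n : nat}.
Local Notation E := 'rV[R]_n.
Local Notation mu := (@lebesgue_rV R n).
Implicit Types (Omega : set E) (f g : E -> R).

(* The library norm of 'rV[R]_n is the sup norm, hence this Euclidean one; the
   topology of 'rV[R]_n is the usual one. *)
Definition enorm (x : E) : R := Num.sqrt (\sum_i x ord0 i ^+ 2).

Definition eball (c : E) (r : R) : set E := [set x | enorm (x - c) < r].

Definition diameter (A : set E) : \bar R :=
  ereal_sup [set (enorm (p.1 - p.2))%:E | p in A `*` A].

Definition is_domain (A : set E) : Prop := [/\ A !=set0, open A & connected A].

Definition star_shaped (A B : set E) : Prop :=
  forall x y, A x -> B y ->
    forall t : R, 0 <= t <= 1 -> A ((1 - t) *: x + t *: y).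

(* Elements of L^2(Omega) are represented by functions on R^n whose values
   outside Omega are irrelevant: f \_ Omega is the extension of f by 0.
   Equality in L^2(Omega) is almost everywhere equality in Omega. *)
Definition L2 Omega : set (E -> R) :=
  [set f | (f \_ Omega) \in Lfun mu 2%:E].

Definition dot2 Omega f g : R := \int[mu]_(x in Omega) (f x * g x).

Definition norm2 Omega f : R := fine ('N[mu]_2%:E[EFin \o (f \_ Omega)]).

Definition avg Omega f : R := (fine (mu Omega))^-1 * \int[mu]_(x in Omega) f x.

Definition L20 Omega : set (E -> R) := [set f | L2 Omega f /\ avg Omega f = 0].

Definition partial (i : 'I_n) f : E -> R := 'D_(delta_mx ord0 i) f.

Definition smooth f : Prop := forall s : seq 'I_n,
  let fs := foldr partial f s in
  continuous fs /\ forall i x, derivable fs x (delta_mx ord0 i).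

(* C_0^oo(Omega) *)
Definition testfun Omega : set (E -> R) :=
  [set phi | [/\ smooth phi, compact (closure [set x | phi x != 0]) &
                 closure [set x | phi x != 0] `<=` Omega]].

(* An element of H^1(Omega) is a pair made of a function and its weak gradient;
   the latter is unique up to almost everywhere equality in Omega. *)
Definition jet : Type := ((E -> R) * ('I_n -> E -> R))%type.

Definition weak_grad Omega f (g : 'I_n -> E -> R) : Prop :=
  forall i phi, testfun Omega phi ->
    dot2 Omega f (partial i phi) = - dot2 Omega (g i) phi.

Definition H1 Omega : set jet :=
  [set w | [/\ L2 Omega w.1, forall i, L2 Omega (w.2 i) &
               weak_grad Omega w.1 w.2]].

Definition seminorm1 Omega (w : jet) : R :=
  Num.sqrt (\sum_i norm2 Omega (w.2 i) ^+ 2).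

Definition norm1 Omega (w : jet) : R :=
  Num.sqrt (norm2 Omega w.1 ^+ 2 + seminorm1 Omega w ^+ 2).

Definition test_jet (phi : E -> R) : jet := (phi, fun i => partial i phi).

(* closure of C_0^oo(Omega) in H^1(Omega) *)
Definition H10 Omega : set jet :=
  [set w | H1 Omega w /\ forall e : R, 0 < e ->
     exists2 phi, testfun Omega phi & norm1 Omega (w - test_jet phi) < e].

(* Vector fields of [H^1_0(Omega)]^n *)
Definition H10v Omega : set ('I_n -> jet) := [set u | forall i, H10 Omega (u i)].

Definition seminorm1v Omega (u : 'I_n -> jet) : R :=
  Num.sqrt (\sum_i seminorm1 Omega (u i) ^+ 2).

Definition divergence (u : 'I_n -> jet) : E -> R := fun x => \sum_i (u i).2 i x.

Definition nonzerov Omega (u : 'I_n -> jet) : Prop :=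
  exists i, ~ ((u i).1 = cst 0 %[ae mu in Omega]).

(* The dual of [H^1_0(Omega)]^n; only the values on [H10v Omega] matter. *)
Definition Hm1v Omega : set (('I_n -> jet) -> R) := [set L |
  (forall (a : R) u v, H10v Omega u -> H10v Omega v ->
     L (a *: u + v) = a * L u + L v) /\
  exists C : R, forall u, H10v Omega u -> `|L u| <= C * seminorm1v Omega u].

Definition normm1 Omega (L : ('I_n -> jet) -> R) : \bar R :=
  ereal_sup [set (L v / seminorm1v Omega v)%:E |
             v in H10v Omega `&` nonzerov Omega].

(* The distribution grad f, tested against phi in [C_0^oo(Omega)]^n *)
Definition dist_grad Omega f (phi : 'I_n -> E -> R) : R :=
  - dot2 Omega f (fun x => \sum_i partial i (phi i) x).

(* grad f as an element of H^-1: the continuous linear extension of the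
   distribution [dist_grad Omega f] from [C_0^oo(Omega)]^n to its closure
   [H^1_0(Omega)]^n. *)
Definition grad Omega f : ('I_n -> jet) -> R :=
  get [set L | Hm1v Omega L /\ forall phi, (forall i, testfun Omega (phi i)) ->
     L (fun i => test_jet (phi i)) = dist_grad Omega f phi].

(* Suprema and infima are taken in the extended reals, where 0^-1 = +oo and
   +oo^-1 = 0. *)
Definition C_NL0 Omega : \bar R :=
  ereal_sup [set ((norm2 Omega (f \- cst (avg Omega f)))%:E /
                  normm1 Omega (grad Omega f))%E | f in
    L2 Omega `&` [set f | ~ exists c : R, f = cst c %[ae mu in Omega]]].

Definition beta0 Omega : \bar R :=
  ereal_inf [set ereal_sup
      [set (dot2 Omega (divergence u) f /
            (seminorm1v Omega u * norm2 Omega f))%:E |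
       u in H10v Omega `&` nonzerov Omega]
    | f in L20 Omega `&` [set f | ~ (f = cst 0 %[ae mu in Omega])]].

End sobolev.

(* Main.v *)
Require Import Defs.
From mathcomp Require Import all_boot all_order all_algebra.
From mathcomp Require Import all_classical all_reals all_analysis.
From mathcomp Require Import measurable_realfun ring lra.
Import Order.TTheory GRing.Theory Num.Theory.
Import numFieldNormedType.Exports.
Set Implicit Arguments. Unset Strict Implicit. Unset Printing Implicit Defensive.
Local Open Scope classical_set_scope.
Local Open Scope ring_scope.

(* Since test fields are dense in [H^1_0]^n, grad f acts on [H^1_0]^n as
   u |-> - (f, div u), and (1, div u) = 0 there; hence |grad f|_{-1} = S(f0),
   where f0 = f - Pi^0 f and S(g) = sup_u (div u, g) / |u|_1. Both constants
   are thus governed by the ratios S(g) / |g|_0 for nonzero g of zero average: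
   C_NL0 is the supremum of their inverses and beta_0 is their infimum.
   Testing S(g) with a field u such that div u = g and |u|_1 <= C_BA0 |g|_0
   gives S(g) >= |g|_0 / C_BA0.
   That test fields belong to H^1_0 at all is integration by parts, i.e.
   int d_i F = 0 for F of class C^1 with compact support: the difference
   quotients of F have integral 0 by translation invariance, and they converge
   boundedly to d_i F. *)

(** * The pre-Hilbert space L^2 *)

Section square_integrable.
Context {R : realType} {n : nat}.
Local Notation E := 'rV[R]_n.
Local Notation mu := (@lebesgue_rV R n).
Variables (Omega : set E) (mO : measurable Omega).
Implicit Types (f g h : E -> R) (a : R).

Lemma L2_measurable f : L2 Omega f -> measurable_fun Omega f.
Proof.
rewrite /L2/= => /sub_Lfun_mfun; rewrite inE/= => mf.
exact/(measurable_restrictT _ mO).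
Qed.

Lemma L2_integrableM f g : L2 Omega f -> L2 Omega g ->
  mu.-integrable Omega (EFin \o (f \* g)).
Proof.
move=> f2 g2; have := Lfun2_mul_Lfun1 f2 g2 => /Lfun1_integrable.
move=> fg; apply/(integrable_mkcond _ mO).
apply: eq_integrable fg => // x _; rewrite /= !patchE.
by case: ifPn => // _; rewrite mulr0.
Qed.

(** Reduces membership to measurability and integrability of the square, so that domination
    arguments can be used to produce elements of [L2]. *)
Lemma L2P f : L2 Omega f <->
  measurable_fun Omega f /\ mu.-integrable Omega (EFin \o (f \* f)).
Proof.
split=> [f2|[mf fi]]; first by split; [exact: L2_measurable|exact: L2_integrableM].
have mf' : measurable_fun setT (f \_ Omega) by exact/(measurable_restrictT _ mO).
rewrite /L2/= inE; apply/andP; rewrite !inE/=; split => //.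
rewrite /finite_norm unlock/= poweR_lty//.
have /integrableP[_] := fi; apply: le_lt_trans.
rewrite [leRHS]integral_mkcond; apply: ge0_le_integral => //=.
- apply/measurable_EFinP; apply: (measurableT_comp (measurable_powR 2)).
  exact: measurableT_comp.
- apply/(measurable_restrictT _ mO)/measurable_EFinP; apply: measurableT_comp => //.
  exact: measurable_funM.
- move=> x _; rewrite !patchE; case: ifPn => _.
    by rewrite lee_fin normrM powR_mulrn.
  by rewrite normr0 lee_fin powR0.
Qed.

Lemma L2D f g : L2 Omega f -> L2 Omega g -> L2 Omega (f \+ g).
Proof.
rewrite /L2/= => f2 g2.
rewrite (_ : _ \_ _ = (f \_ Omega) + (g \_ Omega)); last first.
  by apply/funext => x; rewrite !fctE !patchE; case: ifPn; rewrite ?addr0.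
have p1 : (1 <= 2%:E :> \bar R)%E by rewrite lee_fin ler1n.
have [_] := Lfun_addr_closed mu p1; exact.
Qed.

Lemma L2Z a f : L2 Omega f -> L2 Omega (a \*o f).
Proof.
rewrite /L2/= => f2.
rewrite (_ : _ \_ _ = a \o* (f \_ Omega)); last first.
  by apply/funext => x /=; rewrite !patchE; case: ifPn; rewrite ?mul0r//= mulrC.
by apply: Lfun_scale => //; rewrite ler1n.
Qed.

Lemma L2B f g : L2 Omega f -> L2 Omega g -> L2 Omega (f \- g).
Proof.
move=> f2 g2; rewrite (_ : _ \- _ = f \+ ((-1) \*o g)).
  by apply: L2D => //; exact: L2Z.
by apply/funext => x /=; rewrite mulN1r.
Qed.

Lemma L2_0 : L2 Omega (cst 0).
Proof.
apply/L2P; split; first exact: measurable_cst.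
by apply: eq_integrable (integrable0 _ _) => // x _ /=; rewrite mulr0.
Qed.

Lemma L2_sum (I : Type) (r : seq I) (F : I -> E -> R) :
  (forall i, L2 Omega (F i)) -> L2 Omega (fun x => \sum_(i <- r) F i x).
Proof.
move=> F2; elim: r => [|i r IH].
  by under eq_fun do rewrite big_nil; exact: L2_0.
by under eq_fun do rewrite big_cons; exact: L2D.
Qed.

Lemma dot2C f g : dot2 Omega f g = dot2 Omega g f.
Proof. by apply: eq_Rintegral => x _; rewrite mulrC. Qed.

Lemma dot2Dr f g h : L2 Omega f -> L2 Omega g -> L2 Omega h ->
  dot2 Omega f (g \+ h) = dot2 Omega f g + dot2 Omega f h.
Proof.
move=> f2 g2 h2; rewrite /dot2 -RintegralD//; [|exact: L2_integrableM..].
by apply: eq_Rintegral => x _ /=; rewrite mulrDr.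
Qed.

Lemma dot2Zr a f g : L2 Omega f -> L2 Omega g ->
  dot2 Omega f (a \*o g) = a * dot2 Omega f g.
Proof.
move=> f2 g2; rewrite /dot2 -RintegralZl//; last exact: L2_integrableM.
by apply: eq_Rintegral => x _ /=; rewrite mulrCA.
Qed.

Lemma dot2Br f g h : L2 Omega f -> L2 Omega g -> L2 Omega h ->
  dot2 Omega f (g \- h) = dot2 Omega f g - dot2 Omega f h.
Proof.
move=> f2 g2 h2; rewrite /dot2 -RintegralB//; [|exact: L2_integrableM..].
by apply: eq_Rintegral => x _ /=; rewrite mulrBr.
Qed.

Lemma dot2Bl f g h : L2 Omega f -> L2 Omega g -> L2 Omega h ->
  dot2 Omega (f \- g) h = dot2 Omega f h - dot2 Omega g h.
Proof. by move=> *; rewrite dot2C dot2Br// ![dot2 _ h _]dot2C. Qed.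

Lemma dot2_sumr (I : Type) (r : seq I) (F : I -> E -> R) f :
  L2 Omega f -> (forall i, L2 Omega (F i)) ->
  dot2 Omega f (fun x => \sum_(i <- r) F i x) = \sum_(i <- r) dot2 Omega f (F i).
Proof.
move=> f2 F2; elim: r => [|i r IH].
  rewrite big_nil /dot2; under eq_Rintegral do rewrite big_nil mulr0.
  by rewrite Rintegral_cst// mul0r.
rewrite big_cons -IH -dot2Dr//; last exact: L2_sum.
by under eq_fun do rewrite big_cons.
Qed.

Lemma dot2_ge0 f : 0 <= dot2 Omega f f.
Proof. by apply: Rintegral_ge0 => x _; rewrite -expr2 sqr_ge0. Qed.

Lemma norm2_ge0 f : 0 <= norm2 Omega f.
Proof. by rewrite fine_ge0// Lnorm_ge0. Qed.

Lemma norm2E f : norm2 Omega f ^+ 2 = dot2 Omega f f.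
Proof.
rewrite /norm2 /dot2 Rintegral_mkcond unlock /Rintegral.
set I := (\int[mu]_x _)%E.
have -> : (\int[mu]_x ((fun x0 => f x0 * f x0) \_ Omega x)%:E)%E = I.
  apply: eq_integral => x _; rewrite /= !patchE.
  case: ifPn => _ /=; last by rewrite normr0 powR0.
  by rewrite powR_mulrn// real_normK ?num_real// expr2.
have I0 : (0 <= I)%E by apply: integral_ge0 => x _; rewrite poweR_ge0.
case: I I0 => [r| |]//=.
  by rewrite lee_fin => r0; rewrite -powR_mulrn ?powR_ge0// -powRrM mulVf// powRr1.
(* If the integral of the square is infinite, [fine] sends both sides to 0, so the identity holds
   without assuming f in [L2]. *)
by rewrite gt_eqF// expr0n.
Qed.

Lemma eq_norm2 f g : {in Omega, f =1 g} -> norm2 Omega f = norm2 Omega g.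
Proof.
move=> fg; rewrite /norm2; congr (fine (Lnorm _ _ (EFin \o _))).
by apply/funext => x; rewrite !patchE; case: ifPn => // xO; rewrite fg.
Qed.

Lemma dot2_eq0 f : L2 Omega f -> dot2 Omega f f = 0 ->
  f = cst 0 %[ae mu in Omega].
Proof.
move=> f2 f0; have fi := L2_integrableM f2 f2.
have mf : measurable_fun Omega (EFin \o (f \* f)) by exact: (measurable_int mu).
have : (\int[mu]_(x in Omega) `|(f x * f x)%:E| = 0)%E.
  transitivity (\int[mu]_(x in Omega) (f x * f x)%:E)%E.
    by apply: eq_integral => x _; rewrite /= ger0_norm// -expr2 sqr_ge0.
  by rewrite -(fineK (integrable_fin_num mO fi)); congr (_%:E); exact: f0.
move=> /(ae_eq_integral_abs mu mO mf).1; apply: filterS => x /= + Ox => /(_ Ox) [].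
by move/eqP; rewrite mulf_eq0 orbb => /eqP.
Qed.

Lemma norm2_eq0 f : L2 Omega f -> norm2 Omega f = 0 -> f = cst 0 %[ae mu in Omega].
Proof. by move=> f2 f0; apply: dot2_eq0 => //; rewrite -norm2E f0 expr0n. Qed.

Lemma ae_eq_dot2r f g h : L2 Omega f -> L2 Omega g -> L2 Omega h ->
  g = h %[ae mu in Omega] -> dot2 Omega f g = dot2 Omega f h.
Proof.
move=> f2 g2 h2 gh; congr fine; apply: ae_eq_integral => //.
- by have /integrableP[] := L2_integrableM f2 g2.
- by have /integrableP[] := L2_integrableM f2 h2.
by apply: filterS gh => x /= gh Ox; rewrite gh.
Qed.

Lemma ae0_norm2 f : L2 Omega f -> f = cst 0 %[ae mu in Omega] -> norm2 Omega f = 0.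
Proof.
move=> f2 f0; apply/eqP; rewrite -sqrf_eq0 norm2E (ae_eq_dot2r f2 f2 L2_0 f0).
rewrite /dot2; under eq_Rintegral do rewrite mulr0.
by rewrite Rintegral_cst// mul0r.
Qed.

(** The quadratic $t \mapsto \|f - t g\|^2 = A - 2tB + t^2 C$ is nonnegative, so its discriminant is
    not positive. *)
Lemma cauchy_schwarz f g : L2 Omega f -> L2 Omega g ->
  `|dot2 Omega f g| <= norm2 Omega f * norm2 Omega g.
Proof.
move=> f2 g2; rewrite -ler_sqr ?nnegrE ?mulr_ge0 ?norm2_ge0//.
rewrite real_normK ?num_real// exprMn !norm2E.
set A := dot2 _ f f; set B := dot2 _ f g; set C := dot2 _ g g.
have Q t : 0 <= A - 2 * t * B + t ^+ 2 * C.
  have tg : L2 Omega (t \*o g) by exact: L2Z.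
  have := dot2_ge0 (f \- (t \*o g)).
  rewrite dot2Br//; last exact: L2B.
  rewrite !dot2Bl// !dot2Zr// [dot2 _ (_ \*o _) f]dot2C [dot2 _ (_ \*o _) g]dot2C.
  by rewrite !dot2Zr// -/A -/B -/C; congr (_ <= _); ring.
have A0 : 0 <= A by exact: dot2_ge0.
have : 0 <= C by exact: dot2_ge0.
rewrite le_eqVlt => /predU1P[C0|C0].
  (* With C = 0 the quadratic is affine in t; if B were nonzero, it would take the value -1 at t =
     (A + 1) / (2B). *)
  rewrite -C0 mulr0; case: (eqVneq B 0) => [->|B0]; first by rewrite expr0n.
  have := Q ((A + 1) / (2 * B)); rewrite -C0.
  rewrite (_ : _ + _ = -1); last by field.
  by rewrite lerNr oppr0 ler10.
(* The minimum of the quadratic is attained at t = B / C. *)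
have := Q (B / C); rewrite (_ : _ + _ = (A * C - B ^+ 2) / C); last first.
  by field; rewrite gt_eqF.
by rewrite pmulr_lge0 ?invr_gt0// subr_ge0.
Qed.

Lemma norm2Z a f : L2 Omega f -> norm2 Omega (a \*o f) = `|a| * norm2 Omega f.
Proof.
move=> f2; apply/eqP; rewrite -(@eqrXn2 _ 2) ?mulr_ge0 ?norm2_ge0//.
rewrite exprMn !norm2E real_normK ?num_real// dot2Zr//; last exact: L2Z.
by rewrite dot2C dot2Zr// mulrA -expr2.
Qed.

Lemma norm2D f g : L2 Omega f -> L2 Omega g ->
  norm2 Omega (f \+ g) <= norm2 Omega f + norm2 Omega g.
Proof.
move=> f2 g2; have fg2 := L2D f2 g2.
rewrite -ler_sqr ?nnegrE ?addr_ge0 ?norm2_ge0// norm2E sqrrD !norm2E.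
rewrite dot2Dr// ![dot2 _ (_ \+ _) _]dot2C !dot2Dr// [dot2 _ g f]dot2C.
have := le_trans (ler_norm _) (cauchy_schwarz f2 g2); lra.
Qed.

Lemma norm2_sum (I : Type) (r : seq I) (F : I -> E -> R) :
  (forall i, L2 Omega (F i)) ->
  norm2 Omega (fun x => \sum_(i <- r) F i x) <= \sum_(i <- r) norm2 Omega (F i).
Proof.
move=> F2; elim: r => [|i r IH].
  rewrite big_nil; under eq_fun do rewrite big_nil.
  by rewrite ae0_norm2//; [exact: L2_0|exact: aeW].
rewrite big_cons; under eq_fun do rewrite big_cons.
apply: le_trans (norm2D _ _) _ => //; first exact: L2_sum.
by rewrite lerD2l.
Qed.

End square_integrable.

(** * Translation invariance and integration by parts *)

Section translation.
Context {R : realType}.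

Lemma measurable_addr (a : R) :
  measurable_fun setT ((fun x => x + a) : measurableTypeR R -> measurableTypeR R).
Proof. exact: measurable_funD. Qed.

(** The pushforward of Lebesgue measure by the shift gives each half-open interval its length, and
    this characterizes Lebesgue measure. *)
Lemma lebesgue_measure_translation (a : R) (A : set (measurableTypeR R)) :
  measurable A ->
  lebesgue_measure ((fun x : measurableTypeR R => x + a) @^-1` A) = lebesgue_measure A.
Proof.
move=> mA; have ma := measurable_addr a.
pose m := pushforward lebesgue_measure
  ((fun x => x + a) : measurableTypeR R -> measurableTypeR R).
apply/esym; rewrite -[RHS]/(m A).
apply: lebesgue_measure_unique => //= _ [[x y]] _ <-.
rewrite /m /pushforward (_ : _ @^-1` _ = `]x - a, y - a]%classic); last first.
  by apply/seteqP; split=> z; rewrite /= !in_itv/= ltrBlDr lerBrDr.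
rewrite !lebesgue_measure_itv/= !lte_fin ltrD2r -!EFinB.
by rewrite (_ : y - a - (x - a) = y - x)//; ring.
Qed.

Lemma measurable_rV_add n (v : 'rV[R]_n) :
  measurable_fun [set: 'rV[R]_n] (fun x => x + v).
Proof.
apply: measurable_fun_rV => i.
rewrite (_ : _ \o _ = (fun x : measurableTypeR R => x + v ord0 i) \o rV_coord i).
  exact: measurableT_comp (measurable_addr _) (measurable_rV_coord i).
by apply/funext => x /=; rewrite /rV_coord mxE.
Qed.

(** Induction on the dimension. Through [consrV] the shift acts separately on the first coordinate
    and on the others, so the shifted product measure agrees with the product measure on rectangles,
    hence everywhere. *)
Lemma lebesgue_rV_translation n (v : 'rV[R]_n) (A : set 'rV[R]_n) :
  measurable A ->
  lebesgue_rV ((fun x => x + v) @^-1` A) = lebesgue_rV A.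
Proof.
rewrite /lebesgue_rV; elim: n v A => [|n IH] v A mA.
  apply: congr1; rewrite [X in X @^-1` _](_ : _ = id)//.
  by apply/funext => x /=; rewrite [LHS]thinmx0 [RHS]thinmx0.
rewrite /= /lebesgue_rV_step /pushforward.
pose w : 'rV[R]_n := \row_i v ord0 (lift ord0 i).
pose T (p : measurableTypeR R * 'rV[R]_n) : measurableTypeR R * 'rV[R]_n :=
  (p.1 + v ord0 ord0, p.2 + w).
have mT : measurable_fun setT T.
  apply/measurable_fun_pairP; split.
    exact: measurableT_comp (measurable_addr _) measurable_fst.
  exact: measurableT_comp (measurable_rV_add _) measurable_snd.
have mcA : measurable (consrV @^-1` A).
  by rewrite -[X in measurable X]setTI; exact: measurable_consrV.
rewrite (_ : _ @^-1` (_ @^-1` A) = T @^-1` (consrV @^-1` A)); last first.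
  apply/funext => p /=; congr (A _); apply/rowP => i; rewrite mxE -[0]/(@ord0 0).
  by case: (unliftP ord0 i) => [j ->|->]; rewrite ?consrV0// !consrVS !mxE.
pose m := pushforward (lebesgue_measure \x lebesgue_rV_rec n)%E T.
rewrite [RHS](@product_measure_unique _ _ _ _ _ _ _ m)// => B C mB mC.
rewrite /m /= /pushforward. 
rewrite (_ : _ @^-1` _ =
  ((fun x : measurableTypeR R => x + v ord0 ord0) @^-1` B) `*`
  ((fun x => x + w) @^-1` C)); last first.
  by apply/seteqP; split => -[].
rewrite product_measure1E//.
- by congr (_ * _)%E; [exact: lebesgue_measure_translation|exact: IH].
- by rewrite -[X in measurable X]setTI; exact: measurable_addr.
- by rewrite -[X in measurable X]setTI; exact: measurable_rV_add.
Qed.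

Lemma integral_translation n (v : 'rV[R]_n) (f : 'rV[R]_n -> \bar R) :
  measurable_fun setT f -> lebesgue_rV.-integrable setT (fun x => f (x + v)) ->
  (\int[lebesgue_rV]_x f (x + v)%R = \int[lebesgue_rV]_x f x)%E.
Proof.
move=> mf fi; have mv := measurable_rV_add v.
rewrite -[LHS](@integral_pushforward _ _ _ _ _ _ mv _ setT)//.
by apply: eq_measure_integral => /= A mA _; exact: lebesgue_rV_translation.
Qed.

End translation.

(** * Compactly supported functions and the vanishing integral of a partial derivative *)

Section compact_support.
Context {R : realType} {n : nat}.
Local Notation E := 'rV[R]_n.
Local Notation mu := (@lebesgue_rV R n).
Implicit Types (f F : E -> R).

(** A closed cube of finite measure, used to enclose supports and, later, the bounded domain;
    multiples of its indicator are the dominating functions. *)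
Definition box (M : R) : set E :=
  [set x | forall j, `[- M, M]%classic (x ord0 j : measurableTypeR R)].

Lemma measurable_rV_box (A : 'I_n -> set (measurableTypeR R)) :
  (forall j, measurable (A j)) -> measurable [set x : E | forall j, A j (x ord0 j)].
Proof.
move=> mA; rewrite (_ : [set _ | _] = \bigcap_(j in [set: 'I_n]) (rV_coord j @^-1` A j)).
  apply: fin_bigcap_measurable => // j _.
  by rewrite -[X in measurable X]setTI; exact: measurable_rV_coord.
by apply/seteqP; split=> [x Bx j _|x Bx j]; [exact: Bx|exact: (Bx j)].
Qed.

Lemma measurable_box M : measurable (box M).
Proof. by apply: (@measurable_rV_box (fun=> _)) => _; exact: measurable_itv. Qed.

Lemma lebesgue_box_lty M : (mu (box M) < +oo)%E.
Proof.
rewrite (@lebesgue_rV_box _ _ (fun=> `[- M, M]%classic)) => [|j]; last exact: measurable_itv.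
rewrite ltey_eq; apply/orP; left; apply: prode_fin_num => j _.
by rewrite lebesgue_measure_itv/=; case: ifP.
Qed.

Lemma rV_coord_le_norm (x : E) j : `|x ord0 j| <= `|x|.
Proof.
rewrite [leRHS]mx_normrE.
exact: (@le_bigmax _ _ _ 0 (fun ij => `|x ij.1 ij.2|) (ord0, j)).
Qed.

Lemma norm_le_box (x : E) M : `|x| <= M -> box M x.
Proof.
move=> xM j; rewrite /= in_itv/= -ler_norml.
exact: le_trans (rV_coord_le_norm _ _) xM.
Qed.

Lemma continuous_measurable_rV f : continuous f -> measurable_fun setT f.
Proof.
move=> /continuousP cf; apply: (measurability _ (RGenOpens.measurableE R)).
move=> _ [_ [a [b ->] <-]]; rewrite setTI; apply: open_measurable_rV.
exact/cf/interval_open.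
Qed.

Lemma integrable_box_cst (C M : R) : mu.-integrable setT (fun x => (C * \1_(box M) x)%:E).
Proof.
have mB := measurable_box M.
have m1 : measurable_fun setT (fun x => (C * \1_(box M) x)).
  by apply: measurable_funM => //; exact: measurable_indic.
apply/integrableP; split; first exact/measurable_EFinP.
rewrite (_ : (\int[mu]_x _)%E = (\int[mu]_(x in box M) `|C|%:E)%E).
  by rewrite integral_cst// lte_mul_pinfty// ?lee_fin// lebesgue_box_lty.
rewrite [RHS]integral_mkcond; apply: eq_integral => x _.
by rewrite patchE indicE; case: ifP => _ /=; rewrite ?mulr1// mulr0 normr0.
Qed.

Lemma integrable_dominated_box f (C M : R) : measurable_fun setT f ->
  (forall x, `|f x| <= C * \1_(box M) x) -> mu.-integrable setT (EFin \o f).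
Proof.
move=> mf fC; apply: (le_integrable measurableT _ _ (integrable_box_cst C M)).
  exact/measurable_EFinP.
by move=> x _; rewrite /= lee_fin (le_trans (fC x))// ler_norm.
Qed.

Lemma compact_support_bounded f M : continuous f ->
  (forall x, f x != 0 -> `|x| <= M) ->
  exists2 C, 0 <= C & forall x, `|f x| <= C * \1_(box M) x.
Proof.
move=> cf fM; pose K := [set x : E | `|x| <= M].
have cK : compact K.
  apply: bounded_closed_compact.
    exists M; split; first exact: num_real.
    by move=> N MN x /= /le_trans; apply; exact: ltW.
  rewrite (_ : K = Num.norm @^-1` [set r : R | r <= M])//.
  apply: closed_comp => [x _|]; first exact: norm_continuous.
  exact: closed_le.
have : compact (f @` K) by apply: continuous_compact => //; exact: continuous_subspaceT.
move=> /compact_bounded[N [_ /(_ (`|N| + 1))]].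
(* Every number above N is a bound on the image; [|N| + 1] is one that is also nonnegative. *)
rewrite (le_lt_trans (ler_norm _)) ?ltrDl// => /(_ isT) H.
exists (`|N| + 1); first by rewrite addr_ge0.
move=> x; case: (eqVneq (f x) 0) => [->|fx0].
  by rewrite normr0 mulr_ge0 ?addr_ge0// indicE.
have xK := fM _ fx0; rewrite indicE mem_set ?mulr1; last exact: norm_le_box.
by apply: H; exists x.
Qed.

(** The set where |x| > M is open, so f vanishes near each of its points and has zero derivative
    there. *)
Lemma partial_support f M i : (forall x, f x != 0 -> `|x| <= M) ->
  forall x, partial i f x != 0 -> `|x| <= M.
Proof.
move=> fM x; apply: contraNT; rewrite -ltNge => Mx.
rewrite /partial (@near_eq_derive _ _ _ f (cst 0)) ?derive_cst//.
have : \forall y \near x, M < `|y|.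
  by apply: (@cvgr_norm_gt R E E (nbhs x) _ idfun x _ M Mx); exact: cvg_id.
apply: filterS => y My; apply/eqP; apply: contraTT My => /fM.
by rewrite -leNgt.
Qed.

(** The mean value theorem applied to f along the line through x in direction i. It bounds the
    difference quotients uniformly in the step, as dominated convergence requires. *)
Lemma partial_mean_value f i (C : R) : (forall x, derivable f x (delta_mx ord0 i)) ->
  (forall x, `|partial i f x| <= C) ->
  forall x (h : R), 0 < h -> `|f (h *: delta_mx ord0 i + x) - f x| <= C * h.
Proof.
move=> df fC x h h0; set e := delta_mx ord0 i : E.
pose g (t : R) := f (t *: e + x).
have gE t s : g (s *: 1 + t) = f (s *: e + (t *: e + x)).
  by rewrite /g scalerDl addrA [s *: 1]mulr1.
have dg (t : R) : is_derive t 1 g (partial i f (t *: e + x)).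
  have E1 : (fun s : R => s^-1 *: ((g \o shift t) (s *: 1) - g t)) =
      (fun s : R => s^-1 *: ((f \o shift (t *: e + x)) (s *: e) - f (t *: e + x))).
    by apply/funext => s /=; rewrite gE.
  apply: DeriveDef; first by rewrite /derivable E1; exact: df.
  by rewrite /derive E1.
have cg : {within `[0, h], continuous g}.
  apply: derivable_within_continuous => t _.
  exact: ex_derive.
have [c _] := MVT h0 (fun t _ => dg t) cg.
rewrite /g scale0r add0r subr0 => ->.
by rewrite normrM (gtr0_norm h0) ler_pM2r.
Qed.

Lemma Rintegral_partial f i M : continuous f ->
  (forall x, derivable f x (delta_mx ord0 i)) -> continuous (partial i f) ->
  (forall x, f x != 0 -> `|x| <= M) ->
  \int[mu]_x partial i f x = 0.
Proof.
move=> cf df cpf fM; set e := delta_mx ord0 i : E.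
have [A A0 fA] := compact_support_bounded cf fM.
have [C C0 fC] := compact_support_bounded cpf (partial_support fM).
have mf := continuous_measurable_rV cf.
have fC' x : `|partial i f x| <= C.
  by rewrite (le_trans (fC x))// ler_piMr// indicE lern1 leq_b1.
pose h (k : nat) : R := k.+1%:R^-1.
have h0 k : 0 < h k by rewrite invr_gt0.
have h1 k : h k <= 1 by rewrite invf_le1 ?ler1n.
(* The steps [h k] are at most 1, so the shifted functions all have their support in the ball of
   this radius. *)
pose N := M + `|e|.
have shiftN k x : f (h k *: e + x) != 0 -> `|x| <= N.
  move=> /fM H; rewrite -(addKr (h k *: e) x) (le_trans (ler_normD _ _))// addrC lerD//.
  by rewrite normrN normrZ gtr0_norm// ler_piMl.
have ms k : measurable_fun setT (fun x => f (h k *: e + x)).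
  under eq_fun do rewrite addrC.
  exact: measurableT_comp mf (measurable_rV_add _).
have MN : M <= N by rewrite lerDl.
have fN x : f x != 0 -> box N x.
  by move=> /fM xM; apply: norm_le_box; exact: le_trans MN.
have fi : mu.-integrable setT (EFin \o f) by exact: (integrable_dominated_box mf fA).
have si k : mu.-integrable setT (EFin \o (fun x => f (h k *: e + x))).
  apply: (@integrable_dominated_box _ A N) => // x.
  have [->|/shiftN/norm_le_box xN] := eqVneq (f (h k *: e + x)) 0.
    by rewrite normr0 mulr_ge0// indicE.
  by rewrite indicE (mem_set xN) mulr1 (le_trans (fA _))// ler_piMr// indicE lern1 leq_b1.
pose D k x := (h k)^-1 * (f (h k *: e + x) - f x).
have mD k : measurable_fun setT (EFin \o D k).
  by apply/measurable_EFinP; apply: measurable_funM => //; exact: measurable_funB.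
have Dcvg x : EFin \o D ^~ x @ \oo --> (partial i f x)%:E.
  apply: cvg_EFin; first exact: nearW.
  (* A derivative is a limit over punctured neighbourhoods of 0; the sequence [h] never vanishes and
     tends to 0. *)
  have [+ _] := cvgr_dnbhsP
    (fun s => s^-1 *: ((f \o shift x) (s *: e) - f x)) 0 (partial i f x).
  move=> /(_ (df x) h); apply; split; last exact: cvg_harmonic.
  by move=> k; rewrite gt_eqF.
(* Inside the box this is the mean value bound; outside it both f and its shift vanish. *)
have Dle k x : `|D k x| <= C * \1_(box N) x.
  have [xN|xN] := pselect (box N x).
    rewrite indicE (mem_set xN) mulr1 normrM gtr0_norm ?invr_gt0//.
    by rewrite ler_pdivrMl// mulrC partial_mean_value.
  rewrite /D (_ : f x = 0); last by apply/eqP; apply: contra_notT xN; exact: fN.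
  rewrite (_ : f _ = 0); last first.
    by apply/eqP; apply: contra_notT xN => /shiftN/norm_le_box.
  by rewrite subr0 mulr0 normr0 mulr_ge0// indicE.
(* By translation invariance f and its shift have the same finite integral. *)
have ID k : (\int[mu]_x (D k x)%:E = 0)%E.
  rewrite (_ : (\int[mu]_x _)%E = ((h k)^-1%:E * (\int[mu]_x (f (h k *: e + x) - f x)%:E))%E).
    rewrite integralB_EFin//.
    under eq_integral do rewrite addrC.
    rewrite (@integral_translation _ _ (h k *: e) (EFin \o f)).
    - by rewrite subee ?mule0//; exact: integrable_fin_num.
    - exact/measurable_EFinP.
    - by apply: eq_integrable (si k) => // x _ /=; rewrite addrC.
  rewrite -integralZl//.
  exact: (integrableB measurableT (si k) fi).
have mp : measurable_fun setT (EFin \o partial i f).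
  by apply/measurable_EFinP; exact: (continuous_measurable_rV cpf).
have ae1 : {ae mu, forall x, setT x -> (fun k => (D k x)%:E) @ \oo --> (partial i f x)%:E}.
  by apply: aeW => x _; exact: Dcvg.
have ae2 : {ae mu, forall x k, setT x -> (`|(D k x)%:E| <= (C * \1_(box N) x)%:E)%E}.
  by apply: aeW => x k _; rewrite /= lee_fin.
have [_ _ Icvg] := dominated_convergence measurableT mD mp ae1 (integrable_box_cst C N) ae2.
have : (\int[mu]_x (partial i f x)%:E = 0)%E.
  apply: (cvg_unique _ Icvg); first exact: ereal_hausdorff.
  by apply: cvg_near_cst; apply: nearW => k; exact: ID.
by rewrite /Rintegral => ->.
Qed.

End compact_support.

(** * Test functions and H^1_0 *)

Section test_functions.
Context {R : realType} {n : nat}.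
Local Notation E := 'rV[R]_n.
Local Notation mu := (@lebesgue_rV R n).
Variables (Omega : set E).
Implicit Types (f g phi psi : E -> R) (a : R).

Lemma smooth_continuous f : smooth f -> continuous f.
Proof. by move=> sf; have [] := sf [::]. Qed.

Lemma smooth_derivable f i x : smooth f -> derivable f x (delta_mx ord0 i).
Proof. by move=> sf; have [_] := sf [::]; exact. Qed.

(** [foldr] applies the last index of the list first, so differentiating [partial i f] along s
    amounts to differentiating f along [rcons s i]. *)
Lemma smooth_partial f i : smooth f -> smooth (partial i f).
Proof. by move=> sf s; have := sf (rcons s i); rewrite -cats1 foldr_cat. Qed.

Lemma partial_lin a f g i :
  (forall x, derivable f x (delta_mx ord0 i)) ->
  (forall x, derivable g x (delta_mx ord0 i)) ->
  partial i (a \*o f \+ g) = a \*o partial i f \+ partial i g.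
Proof.
move=> df dg; apply/funext => x; rewrite /partial deriveD//.
  by rewrite deriveMl.
exact: (derivableZ (k := a) (df x)).
Qed.

Lemma smooth_lin a f g : smooth f -> smooth g -> smooth (a \*o f \+ g).
Proof.
move=> sf sg s.
have E s' : foldr partial (a \*o f \+ g) s' =
    a \*o foldr partial f s' \+ foldr partial g s'.
  elim: s' => //= i s' ->; apply: partial_lin => x.
    by have [_] := sf s'; exact.
  by have [_] := sg s'; exact.
have [cf df] := sf s; have [cg dg] := sg s.
rewrite /= E; split=> [x|i x].
  apply: continuousD; last exact: cg.
  by apply: (@continuousM _ _ (cst a)); [exact: cst_continuous|exact: cf].
by apply: derivableD => //; exact: (derivableZ (k := a) (df i x)).
Qed.

(** Spares the computation of supports: any closed compact subset of Omega off which f vanishes will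
    do. *)
Lemma testfun_supportW f (A : set E) : smooth f ->
  compact A -> A `<=` Omega -> [set x | f x != 0] `<=` A -> closed A ->
  testfun Omega f.
Proof.
move=> sf cA AO fA clA.
have clfA : closure [set x | f x != 0] `<=` A.
  by rewrite [X in _ `<=` X](closure_id _).1//; exact: closure_subset.
split => //; last exact: subset_trans AO.
by apply: subclosed_compact cA clfA; exact: closed_closure.
Qed.

Lemma testfun_partial f i : testfun Omega f -> testfun Omega (partial i f).
Proof.
move=> [sf cf fO]; apply: testfun_supportW cf fO _ _; first exact: smooth_partial.
(* Off the closed support, f is zero in a neighbourhood, hence so is its derivative. *)
- move=> x /= dfx; apply: contrapT => xf; move/eqP: dfx; apply.
  rewrite /partial (@near_eq_derive _ _ _ f (cst 0)) ?derive_cst//.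
  have : nbhs x (~` closure [set x | f x != 0]).
    apply: open_nbhs_nbhs; split => //.
    by apply: closed_openC; exact: closed_closure.
  by apply: filterS => y yf; apply: contrapT => /eqP fy; apply: yf; exact: subset_closure.
- exact: closed_closure.
Qed.

Lemma testfun_lin a f g : testfun Omega f -> testfun Omega g ->
  testfun Omega (a \*o f \+ g).
Proof.
move=> [sf cf fO] [sg cg gO].
apply: (@testfun_supportW _ (closure [set x | f x != 0] `|` closure [set x | g x != 0])).
- exact: smooth_lin.
- exact: compactU.
- by move=> x [/fO|/gO].
- move=> x /= fgx; have [fx0|fx] := eqVneq (f x) 0; last by left; exact: subset_closure.
  by right; apply: subset_closure => /=; move: fgx; rewrite fx0 mulr0 add0r.
- by apply: closedU; exact: closed_closure.
Qed.

Lemma testfun_neq0 f x : testfun Omega f -> f x != 0 -> Omega x.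
Proof. by move=> [_ _ fO] fx; apply: fO; exact: subset_closure. Qed.

Lemma testfun_bounded_support f : testfun Omega f ->
  exists M : R, forall x, f x != 0 -> `|x| <= M.
Proof.
move=> [_ /compact_bounded[M [_ H]] _]; have fM := H (M + 1).
rewrite ltrDl in fM; have {}fM := fM ltr01; exists (M + 1) => x fx.
by apply: fM; exact: subset_closure.
Qed.

Lemma testfun_Rintegral f : testfun Omega f ->
  \int[mu]_(x in Omega) f x = \int[mu]_x f x.
Proof.
move=> tf; rewrite Rintegral_mkcond; apply: eq_Rintegral => x _.
rewrite patchE; case: ifPn => // xO; apply/esym/eqP.
by apply: contraNT xO => /(testfun_neq0 tf) /mem_set.
Qed.

Lemma testfun_Rintegral_partial f i : testfun Omega f ->
  \int[mu]_(x in Omega) partial i f x = 0.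
Proof.
move=> tf; rewrite testfun_Rintegral; last exact: testfun_partial.
have [M fM] := testfun_bounded_support tf; have [sf _ _] := tf.
apply: Rintegral_partial fM.
- exact: smooth_continuous.
- by move=> x; exact: smooth_derivable.
- exact/smooth_continuous/smooth_partial.
Qed.

Hypothesis mO : measurable Omega.

Lemma testfun_L2 f : testfun Omega f -> L2 Omega f.
Proof.
move=> tf; have [M fM] := testfun_bounded_support tf; have [sf _ _] := tf.
have cf := smooth_continuous sf.
have [C C0 fC] := compact_support_bounded cf fM.
apply/(L2P mO); split.
  by apply: measurable_funTS; exact: continuous_measurable_rV.
apply: (@integrableS _ _ _ _ setT) => //.
apply: (@integrable_dominated_box _ _ _ (C * C) M).
  by apply: measurable_funM; exact: continuous_measurable_rV.
move=> x; rewrite normrM (le_trans (ler_pM _ _ (fC x) (fC x)))//.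
by rewrite mulrACA -expr2 ler_wpM2l ?mulr_ge0// indicE; case: (_ \in _); rewrite ?mulr1 ?mulr0.
Qed.

(** The product of the two test functions is of class $C^1$ with bounded support, so its partial
    derivative integrates to 0 over the whole space; outside Omega both factors vanish. *)
Lemma testfun_by_parts phi psi i : testfun Omega phi -> testfun Omega psi ->
  dot2 Omega phi (partial i psi) = - dot2 Omega (partial i phi) psi.
Proof.
move=> tphi tpsi; have [sphi _ _] := tphi; have [spsi _ _] := tpsi.
have dphi x : derivable phi x (delta_mx ord0 i) by exact: smooth_derivable.
have dpsi x : derivable psi x (delta_mx ord0 i) by exact: smooth_derivable.
have E : partial i (phi * psi) = (phi \* partial i psi) \+ (partial i phi \* psi).
  by apply/funext => x; rewrite /partial deriveM//=; congr (_ + _); exact: mulrC.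
have cphi := smooth_continuous sphi; have cpsi := smooth_continuous spsi.
have cdphi := smooth_continuous (smooth_partial i sphi).
have cdpsi := smooth_continuous (smooth_partial i spsi).
have [M phiM] := testfun_bounded_support tphi.
have Lphi := testfun_L2 tphi; have Lpsi := testfun_L2 tpsi.
have Ldphi := testfun_L2 (testfun_partial i tphi).
have Ldpsi := testfun_L2 (testfun_partial i tpsi).
apply/eqP; rewrite -subr_eq0 opprK /dot2 -RintegralD//;
  [|exact: L2_integrableM..].
rewrite (_ : Rintegral _ _ _ = \int[mu]_x partial i (phi * psi) x).
  apply/eqP; apply: (@Rintegral_partial _ _ _ _ M).
  - by move=> x; exact: (continuousM (cphi x) (cpsi x)).
  - by move=> x; exact: derivableM.
  - rewrite E => x.
    exact: (continuousD (continuousM (cphi x) (cdpsi x)) (continuousM (cdphi x) (cpsi x))).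
  - by move=> x; rewrite mulf_eq0 negb_or => /andP[/phiM].
rewrite Rintegral_mkcond; apply: eq_Rintegral => x _; rewrite E patchE.
case: ifPn => // xO; have /eqP phi0 : phi x == 0.
  by apply: contraNT xO => /(testfun_neq0 tphi) /mem_set.
have /eqP psi0 : psi x == 0.
  by apply: contraNT xO => /(testfun_neq0 tpsi) /mem_set.
by rewrite /= phi0 psi0 mul0r mulr0 addr0.
Qed.

End test_functions.

(** * Density of test fields, the distributional gradient and the divergence *)

Section H10_theory.
Context {R : realType} {n : nat}.
Local Notation E := 'rV[R]_n.
Local Notation mu := (@lebesgue_rV R n).
Variables (Omega : set E) (mO : measurable Omega).
Implicit Types (f g : E -> R) (a e : R) (w : @jet R n) (u v : 'I_n -> @jet R n).

Lemma ler_sqrt_sum (I : finType) (r : I -> R) i :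
  (forall i, 0 <= r i) -> r i <= Num.sqrt (\sum_i r i ^+ 2).
Proof.
move=> r0; rewrite -[leLHS]ger0_norm// -sqrtr_sqr ler_wsqrtr//.
by rewrite (bigD1 i)//= lerDl sumr_ge0// => j _; rewrite sqr_ge0.
Qed.

Lemma sqrt_sum_ler (I : finType) (r : I -> R) : (forall i, 0 <= r i) ->
  Num.sqrt (\sum_i r i ^+ 2) <= \sum_i r i.
Proof.
move=> r0; have s0 : 0 <= \sum_i r i by apply: sumr_ge0.
rewrite -[leRHS]ger0_norm// -sqrtr_sqr ler_wsqrtr// expr2 mulr_suml.
apply: ler_sum => i _; rewrite expr2 ler_wpM2l//.
by rewrite (bigD1 i)//= lerDl sumr_ge0.
Qed.

Lemma norm2_le_norm1 w : norm2 Omega w.1 <= norm1 Omega w.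
Proof.
rewrite /norm1 -[leLHS]ger0_norm ?norm2_ge0// -sqrtr_sqr ler_wsqrtr//.
by rewrite lerDl sqr_ge0.
Qed.

Lemma norm2_grad_le_seminorm1 w i : norm2 Omega (w.2 i) <= seminorm1 Omega w.
Proof.
by apply: (@ler_sqrt_sum _ (fun i => norm2 Omega (w.2 i))) => j; exact: norm2_ge0.
Qed.

Lemma seminorm1_ge0 w : 0 <= seminorm1 Omega w. Proof. exact: sqrtr_ge0. Qed.

Lemma seminorm1v_ge0 u : 0 <= seminorm1v Omega u. Proof. exact: sqrtr_ge0. Qed.

Lemma seminorm1_le_norm1 w : seminorm1 Omega w <= norm1 Omega w.
Proof.
rewrite /norm1 -[leLHS]ger0_norm ?seminorm1_ge0// -sqrtr_sqr ler_wsqrtr//.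
by rewrite lerDr sqr_ge0.
Qed.

Lemma seminorm1_le_sum w : seminorm1 Omega w <= \sum_i norm2 Omega (w.2 i).
Proof. by apply: sqrt_sum_ler => i; exact: norm2_ge0. Qed.

Lemma norm1_le_sum w :
  norm1 Omega w <= norm2 Omega w.1 + \sum_i norm2 Omega (w.2 i).
Proof.
have s0 := seminorm1_ge0 w; have n0 := norm2_ge0 Omega w.1.
apply: (@le_trans _ _ (norm2 Omega w.1 + seminorm1 Omega w)).
  rewrite /norm1 -[leRHS]ger0_norm ?addr_ge0// -sqrtr_sqr ler_wsqrtr//.
  by rewrite sqrrD addrAC lerDl mulrn_wge0// mulr_ge0.
by rewrite lerD2l seminorm1_le_sum.
Qed.

Lemma seminorm1_le_seminorm1v u i : seminorm1 Omega (u i) <= seminorm1v Omega u.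
Proof.
by apply: (@ler_sqrt_sum _ (fun i => seminorm1 Omega (u i))) => j; exact: seminorm1_ge0.
Qed.

Lemma seminorm1v_le_sum u :
  seminorm1v Omega u <= \sum_i \sum_j norm2 Omega ((u i).2 j).
Proof.
apply: le_trans (_ : \sum_i seminorm1 Omega (u i) <= _).
  by apply: sqrt_sum_ler => i; exact: seminorm1_ge0.
by apply: ler_sum => i _; exact: seminorm1_le_sum.
Qed.

(** Approximation in the $H^1$ norm is the same as approximation of the function and of each partial
    derivative separately in $L^2$, which is easier to handle. *)
Lemma H10P w : H10 Omega w <-> H1 Omega w /\ forall e, 0 < e ->
  exists2 phi, testfun Omega phi & norm2 Omega (w.1 \- phi) < e /\
    forall i, norm2 Omega (w.2 i \- partial i phi) < e.
Proof.
split=> -[wH wa]; split => // e e0.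
  have [phi tphi we] := wa _ e0; exists phi => //; split=> [|i].
    exact: le_lt_trans (norm2_le_norm1 (w - test_jet phi)) we.
  apply: le_lt_trans we; apply: le_trans (seminorm1_le_norm1 _).
  exact: norm2_grad_le_seminorm1 (w - test_jet phi) i.
(* The tolerance is shared between the function and its n derivatives. *)
have e'0 : 0 < e / n.+1%:R by rewrite divr_gt0.
have [phi tphi [w1 w2]] := wa _ e'0; exists phi => //.
apply: le_lt_trans (norm1_le_sum _) _.
rewrite (_ : e = e / n.+1%:R + \sum_(i < n) e / n.+1%:R).
  by rewrite ltr_leD//; apply: ler_sum => i _; exact/ltW/w2.
by rewrite sumr_const card_ord -mulrS -[RHS]mulr_natr divfK// pnatr_eq0.
Qed.

Lemma H1_lin a w w' : H1 Omega w -> H1 Omega w' -> H1 Omega (a *: w + w').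
Proof.
move=> [w1 w2 ww] [w'1 w'2 ww']; split => /=.
- by apply: (L2D _ w'1); exact: L2Z.
- by move=> i; apply: (L2D _ (w'2 i)); exact: (L2Z _ (w2 i)).
- move=> i phi tphi; have Lphi := testfun_L2 mO tphi.
  have Ldphi := testfun_L2 mO (testfun_partial i tphi).
  rewrite dot2C (@dot2Dr _ _ _ mO _ (a \*o w.1) w'.1)//; last exact: L2Z.
  rewrite [X in _ = - X]dot2C (@dot2Dr _ _ _ mO _ (a \*o w.2 i) (w'.2 i))//; last exact: L2Z.
  rewrite !dot2Zr// ![dot2 _ (partial i phi) _]dot2C ww// ww'//.
  by rewrite ![dot2 _ phi _]dot2C; ring.
Qed.

Lemma H10_lin a w w' : H10 Omega w -> H10 Omega w' -> H10 Omega (a *: w + w').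
Proof.
move=> /H10P[wH wa] /H10P[w'H w'a]; apply/H10P; split; first exact: H1_lin.
move=> e e0; have a1 : 0 < `|a| + 1 by rewrite ltr_wpDl.
(* With d this tolerance, the error of the combination is below |a| d + d = e. *)
have e'0 : 0 < e / (`|a| + 1) by rewrite divr_gt0.
have [phi tphi [wp wdp]] := wa _ e'0.
have [psi tpsi [w'p w'dp]] := w'a _ e'0.
have H (f g h k : E -> R) : L2 Omega f -> L2 Omega g -> L2 Omega h -> L2 Omega k ->
    norm2 Omega (f \- h) < e / (`|a| + 1) -> norm2 Omega (g \- k) < e / (`|a| + 1) ->
    norm2 Omega ((a \*o f \+ g) \- (a \*o h \+ k)) < e.
  move=> f2 g2 h2 k2 fh gk.
  rewrite (_ : _ \- _ = (a \*o (f \- h)) \+ (g \- k)); last first.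
    by apply/funext => x /=; ring.
  rewrite (le_lt_trans (norm2D mO (L2Z _ (L2B f2 h2)) (L2B g2 k2)))//.
  rewrite norm2Z//; last exact: L2B.
  rewrite (_ : e = `|a| * (e / (`|a| + 1)) + e / (`|a| + 1)); last first.
    by field; rewrite gt_eqF.
  by rewrite ler_ltD// ler_wpM2l// ltW.
have [w1 w2 _] := wH; have [w'1 w'2 _] := w'H.
exists (a \*o phi \+ psi); first exact: testfun_lin.
split=> [|i]; first by apply: H => //; exact: testfun_L2.
rewrite partial_lin; first by apply: H => //; apply: testfun_L2 => //; exact: testfun_partial.
- by move=> x; case: tphi => sphi _ _; exact: smooth_derivable.
- by move=> x; case: tpsi => spsi _ _; exact: smooth_derivable.
Qed.

Lemma H10v_lin a u v : H10v Omega u -> H10v Omega v -> H10v Omega (a *: u + v).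
Proof. by move=> uH vH i; exact: H10_lin. Qed.

Lemma test_jet_H10 phi : testfun Omega phi -> H10 Omega (test_jet phi).
Proof.
move=> tphi; apply/H10P; split.
  split => /=.
  - exact: testfun_L2.
  - by move=> i; apply: testfun_L2 => //; exact: testfun_partial.
  - by move=> i psi tpsi; exact: testfun_by_parts.
have H f : norm2 Omega (f \- f) = 0.
  rewrite (_ : _ \- _ = cst 0); last by apply/funext => x /=; rewrite subrr.
  by rewrite ae0_norm2//; [exact: L2_0|exact: aeW].
by move=> e e0; exists phi => //; split=> [|i]; rewrite H.
Qed.

Lemma H10v_grad_L2 u i j : H10v Omega u -> L2 Omega ((u i).2 j).
Proof. by move=> uH; have [[_ + _] _] := uH i; exact. Qed.

Lemma L2_divergence u : H10v Omega u -> L2 Omega (divergence u).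
Proof. by move=> uH; apply: L2_sum => // i; exact: H10v_grad_L2. Qed.

Lemma divergence_lin a u v :
  divergence (a *: u + v) = a \*o divergence u \+ divergence v.
Proof. by apply/funext => x; rewrite /divergence /= mulr_sumr -big_split. Qed.

(** The triangle inequality over the n diagonal derivatives. This crude constant suffices for
    continuity of $u \mapsto (f, \mathrm{div}\, u)$. *)
Lemma norm2_divergence_le u : H10v Omega u ->
  norm2 Omega (divergence u) <= n%:R * seminorm1v Omega u.
Proof.
move=> uH; apply: le_trans (norm2_sum mO _ _) _.
  by move=> i; exact: H10v_grad_L2.
rewrite mulr_natl -[n in _ *+ n]card_ord -sumr_const; apply: ler_sum => i _.
exact: le_trans (norm2_grad_le_seminorm1 _ _) (seminorm1_le_seminorm1v _ _).
Qed.

Lemma dot2_divergence_le f u : L2 Omega f -> H10v Omega u ->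
  `|dot2 Omega f (divergence u)| <= norm2 Omega f * n%:R * seminorm1v Omega u.
Proof.
move=> f2 uH; apply: le_trans (cauchy_schwarz mO f2 (L2_divergence uH)) _.
by rewrite -mulrA ler_wpM2l ?norm2_ge0// norm2_divergence_le.
Qed.

Lemma Hm1v_dot2_divergence f : L2 Omega f ->
  Hm1v Omega (fun u => - dot2 Omega f (divergence u)).
Proof.
move=> f2; split=> [a u v uH vH|].
  have uL := L2_divergence uH; have vL := L2_divergence vH.
  by rewrite divergence_lin dot2Dr ?dot2Zr//; [ring|exact: L2Z].
by exists (norm2 Omega f * n%:R) => u uH; rewrite normrN dot2_divergence_le.
Qed.

(** Only the seminorm is controlled, since elements of [Hm1v] are bounded by it. The difference has
    the shape of the linearity clause of [Hm1v]. *)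
Lemma H10v_approx u e : H10v Omega u -> 0 < e ->
  (* The tolerance d chosen below accounts for the n * n derivatives; the added 1 keeps its
     denominator positive even when n = 0. *)
  exists2 phi : 'I_n -> E -> R, forall i, testfun Omega (phi i) &
    seminorm1v Omega ((-1) *: (fun i => test_jet (phi i)) + u) <= e.
Proof.
move=> uH e0; pose d := e / (n%:R * n%:R + 1).
have d0 : 0 < d by rewrite divr_gt0// ltr_wpDl// mulr_ge0.
have /choice[phi phiP] : forall i, exists phi, testfun Omega phi /\
    forall j, norm2 Omega ((u i).2 j \- partial j phi) < d.
  move=> i; have /H10P[_ /(_ d d0)[phi tphi [_ phiu]]] := uH i.
  by exists phi.
exists phi; first by move=> i; have [] := phiP i.
apply: le_trans (seminorm1v_le_sum _) _.
apply: le_trans (_ : \sum_(i < n) \sum_(j < n) d <= _).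
  apply: ler_sum => i _; apply: ler_sum => j _.
  have [_ /(_ j)/ltW] := phiP i; apply: le_trans.
  rewrite le_eqVlt; apply/orP; left; apply/eqP/eq_norm2 => x _ /=.
  by rewrite addrC; congr (_ + _); exact: mulN1r.
have K0 : 0 < n%:R * n%:R + 1 :> R by rewrite ltr_wpDl// mulr_ge0.
rewrite !sumr_const !card_ord -mulrnA -[leLHS]mulr_natr natrM.
rewrite [leRHS](_ : e = d * (n%:R * n%:R + 1)); last by rewrite divfK// gt_eqF.
by rewrite ler_pM2l// lerDl.
Qed.

(** By density: approximating u by a test field t, linearity gives L u - L' u = L (u - t) - L' (u -
    t), which is small by boundedness. *)
Lemma Hm1v_eq (L L' : ('I_n -> @jet R n) -> R) : Hm1v Omega L -> Hm1v Omega L' ->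
  (forall phi : 'I_n -> E -> R, (forall i, testfun Omega (phi i)) ->
     L (fun i => test_jet (phi i)) = L' (fun i => test_jet (phi i))) ->
  forall u, H10v Omega u -> L u = L' u.
Proof.
move=> [Ll [C LC]] [L'l [C' L'C]] LL' u uH.
apply/eqP; rewrite -subr_eq0 -normr_le0.
apply/ler_addgt0Pr => e e0; rewrite add0r.
(* C and C' may be negative, hence the absolute values; adding 1 makes the divisor nonzero. *)
have K0 : 0 < `|C| + `|C'| + 1 by rewrite ltr_wpDl// addr_ge0.
have [phi tphi ue] := H10v_approx uH (divr_gt0 e0 K0).
have phiH : H10v Omega (fun i => test_jet (phi i)).
  by move=> i; exact: test_jet_H10.
set t := fun i => _ in phiH ue.
have wH : H10v Omega ((-1) *: t + u) by exact: H10v_lin.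
have -> : L u - L' u = L ((-1) *: t + u) - L' ((-1) *: t + u).
  by rewrite Ll// L'l// LL'//; ring.
have s0 := seminorm1v_ge0 ((-1) *: t + u).
apply: le_trans (ler_normB _ _) _.
apply: le_trans (lerD (LC _ wH) (L'C _ wH)) _.
rewrite -mulrDl; apply: le_trans (_ : (`|C| + `|C'| + 1) * seminorm1v Omega (-1 *: t + u) <= _).
  rewrite ler_wpM2r// -[leLHS]addr0 lerD//.
  by rewrite lerD// ler_norm.
by rewrite mulrC -ler_pdivlMr.
Qed.

(** The explicit functional is a continuous extension of the distribution, so [get] returns a
    genuine one; by [Hm1v_eq] any two extensions agree on [H10v]. *)
Lemma gradE f u : L2 Omega f -> H10v Omega u ->
  grad Omega f u = - dot2 Omega f (divergence u).
Proof.
move=> f2 uH; rewrite /grad; set S := [set L | _].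
have [gH gt] : S (get S).
  have : S (fun u => - dot2 Omega f (divergence u)).
    by split; [exact: Hm1v_dot2_divergence|].
  exact: getI.
apply: (Hm1v_eq gH (Hm1v_dot2_divergence f2) _ uH) => phi tphi.
by rewrite gt.
Qed.

(** The functional vanishes on test fields, where partial derivatives integrate to 0, and hence
    equals the zero functional on [H10v] by density. *)
Lemma dot2_cst1_divergence u : L2 Omega (cst 1) -> H10v Omega u ->
  dot2 Omega (cst 1) (divergence u) = 0.
Proof.
move=> O1 uH; apply/eqP; rewrite -oppr_eq0; apply/eqP.
have H0 : Hm1v Omega (fun=> 0).
  by split=> [*|]; [rewrite mulr0 addr0|exists 0 => *; rewrite normr0 mul0r].
apply: (Hm1v_eq (Hm1v_dot2_divergence O1) H0 _ uH) => phi tphi.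
rewrite dot2_sumr// => [|i]; last first.
  exact/testfun_L2/testfun_partial.
rewrite big1 ?oppr0// => i _.
rewrite /dot2; under eq_Rintegral do rewrite mul1r.
exact: testfun_Rintegral_partial.
Qed.

(** The weak gradient of a null function is orthogonal to all test functions, yet it is an $L^2$
    limit of derivatives of test functions, which are test functions; so it is orthogonal to
    itself. *)
Lemma H10_ae0_grad w i : H10 Omega w -> w.1 = cst 0 %[ae mu in Omega] ->
  norm2 Omega (w.2 i) = 0.
Proof.
move=> /H10P[[w1 w2 ww] wa] w0; have L0 := L2_0 mO.
have N0 := norm2_ge0 Omega (w.2 i).
have ort phi : testfun Omega phi -> dot2 Omega (w.2 i) phi = 0.
  move=> tphi; have Ldphi := testfun_L2 mO (testfun_partial i tphi).
  have := ww i phi tphi; rewrite dot2C (ae_eq_dot2r mO Ldphi w1 L0 w0).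
  rewrite /dot2; under eq_Rintegral do rewrite mulr0.
  by rewrite Rintegral_cst// mul0r => /esym/eqP; rewrite oppr_eq0 => /eqP.
apply/eqP; rewrite eq_le N0 andbT; apply/ler_addgt0Pr => e e0; rewrite add0r.
have [->|N1] := eqVneq (norm2 Omega (w.2 i)) 0; first exact: ltW.
have {}N0 : 0 < norm2 Omega (w.2 i) by rewrite lt_neqAle eq_sym N1.
have [phi tphi [_ /(_ i) we]] := wa _ e0.
have tdphi := testfun_partial i tphi; have Ldphi := testfun_L2 mO tdphi.
rewrite -(ler_pM2l N0) -expr2 norm2E.
have -> : dot2 Omega (w.2 i) (w.2 i) = dot2 Omega (w.2 i) (w.2 i \- partial i phi).
  by rewrite dot2Br// (ort _ tdphi) subr0.
apply: le_trans (ler_norm _) _.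
apply: le_trans (cauchy_schwarz mO _ (L2B _ _)) _ => //.
by rewrite ler_pM2l// ltW.
Qed.

(** Shows that a field with prescribed nonzero divergence is admissible in the suprema, where
    [nonzerov] looks at function values and not at gradients. *)
Lemma nonzerov_divergence u : H10v Omega u ->
  ~ (divergence u = cst 0 %[ae mu in Omega]) -> nonzerov Omega u.
Proof.
move=> uH d0; apply: contrapT => /forallNP u0; apply: d0.
apply: norm2_eq0 => //; first exact: L2_divergence.
apply/eqP; rewrite eq_le norm2_ge0 andbT.
apply: le_trans (norm2_sum mO _ _) _; first by move=> i; exact: H10v_grad_L2.
by rewrite big1// => i _; apply: H10_ae0_grad => //; exact: contrapT.
Qed.

End H10_theory.

(** Inversion is an order-reversing involution of [0, +oo]. For empty X the left side would be -oo
    and the right side 0. *)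
Lemma ereal_sup_inve (R : realType) (X : set \bar R) : X !=set0 ->
  (forall x, X x -> (0 <= x)%E) ->
  ereal_sup [set x^-1%E | x in X] = (ereal_inf X)^-1%E.
Proof.
move=> [x0 Xx0] X0.
have i0 : (0 <= ereal_inf X)%E by exact/le_ereal_inf_tmp.
have s0 : (0 <= ereal_sup [set x^-1%E | x in X])%E.
  apply: (@le_trans _ _ (x0^-1)%E); first by rewrite inve_ge0 X0.
  by apply: ereal_sup_ubound; exists x0.
apply/eqP; rewrite eq_le; apply/andP; split.
  apply: ge_ereal_sup => _ [x Xx <-]; have x_ge0 := X0 x Xx.
  by rewrite inve_pge ?inE/= ?inve_ge0// inveK ereal_inf_lbound.
rewrite inve_ple ?inE//; apply: le_ereal_inf_tmp => x Xx; have x_ge0 := X0 x Xx.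
by rewrite inve_ple ?inE//; apply: ereal_sup_ubound; exists x.
Qed.

(** * The two constants *)

Section bounded_domain.
Context {R : realType} {n : nat}.
Local Notation E := 'rV[R]_n.
Local Notation mu := (@lebesgue_rV R n).
Implicit Types (Omega : set E) (f g : E -> R) (u : 'I_n -> @jet R n).

Lemma rV_coord_le_enorm (x : E) j : `|x ord0 j| <= enorm x.
Proof.
rewrite /enorm -sqrtr_sqr ler_wsqrtr// (bigD1 j)//= lerDl.
by apply: sumr_ge0 => k _; rewrite sqr_ge0.
Qed.

(** Each coordinate of x - x0 is at most the Euclidean distance, hence at most d. *)
Lemma diameter_box Omega (d : R) x0 : Omega x0 -> diameter Omega = d%:E ->
  Omega `<=` box (`|x0| + d).
Proof.
move=> Ox0 Od x Ox j; rewrite /= in_itv/= -ler_norml.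
have xd : enorm (x - x0) <= d.
  by rewrite -lee_fin -Od; apply: ereal_sup_ubound; exists (x, x0).
rewrite -(subrK (x0 ord0 j) (x ord0 j)) (le_trans (ler_normD _ _))// addrC lerD//.
  exact: rV_coord_le_norm.
by rewrite (le_trans _ xd)// (le_trans _ (rV_coord_le_enorm _ j))// !mxE.
Qed.

Lemma L2_bounded Omega f (C M : R) : measurable Omega -> Omega `<=` box M ->
  measurable_fun setT f -> (forall x, `|f x| <= C) -> L2 Omega f.
Proof.
move=> mO OM mf fC; apply/(L2P mO); split; first exact: measurable_funTS.
have CC : mu.-integrable Omega (fun x => (C * C * \1_(box M) x)%:E).
  by apply: (@integrableS _ _ _ _ setT) => //; exact: integrable_box_cst.
apply: (le_integrable mO _ _ CC).
  by apply/measurable_EFinP; apply: measurable_funTS; exact: measurable_funM.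
move=> x Ox; rewrite /= lee_fin indicE (mem_set (OM _ Ox)) mulr1 !normrM.
by rewrite ler_pM// (le_trans (fC x))// ler_norm.
Qed.

Lemma norm2N Omega f : norm2 Omega (\- f) = norm2 Omega f.
Proof.
apply/eqP; rewrite -(@eqrXn2 _ 2) ?norm2_ge0// !norm2E; apply/eqP.
by apply: eq_Rintegral => x _; rewrite mulrNN.
Qed.

Lemma seminorm1vN Omega u : seminorm1v Omega (- u) = seminorm1v Omega u.
Proof.
congr Num.sqrt; apply: eq_bigr => i _; congr (_ ^+ 2).
by congr Num.sqrt; apply: eq_bigr => j _; congr (_ ^+ 2); exact: norm2N.
Qed.

Lemma H10vN Omega u : measurable Omega -> H10v Omega u -> H10v Omega (- u).
Proof.
(* Closure of [H10v] is available only for combinations of the form [a *: u + v]. *)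
move=> mO uH; rewrite (_ : - u = (-2) *: u + u); first exact: H10v_lin.
by rewrite -[X in _ + X]scale1r -scalerDl (_ : -2 + 1 = -1) ?scaleN1r//; ring.
Qed.

Lemma nonzerovN Omega u : nonzerov Omega u -> nonzerov Omega (- u).
Proof.
move=> [i ui]; exists i => ui0; apply: ui; apply: filterS ui0 => x /= H Ox.
by apply/eqP; rewrite -oppr_eq0; apply/eqP; exact: H.
Qed.

Lemma divergenceN u : divergence (- u) = \- divergence u.
Proof. by apply/funext => x; rewrite /divergence/= -sumrN. Qed.

Variables (Omega : set E) (M : R).
Hypotheses (mO : measurable Omega) (OM : Omega `<=` box M).

Lemma L2_cst c : L2 Omega (cst c).
Proof. by apply: (L2_bounded mO OM (C := `|c|)). Qed.

(** For g in $L^2$ of zero average this is $\|\nabla g\|_{-1,\Omega}$, by [normm1_grad]. *)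
Definition sup_divergence g : \bar R := ereal_sup
  [set (dot2 Omega (divergence u) g / seminorm1v Omega u)%:E |
   u in H10v Omega `&` nonzerov Omega].

Lemma dot2_sub_avg f u : L2 Omega f -> H10v Omega u ->
  dot2 Omega f (divergence u) =
  dot2 Omega (f \- cst (avg Omega f)) (divergence u).
Proof.
move=> f2 uH; have uL := L2_divergence mO uH.
rewrite dot2Bl//; last exact: L2_cst.
rewrite (_ : dot2 Omega (cst _) _ = 0) ?subr0//.
rewrite dot2C (_ : cst _ = (avg Omega f) \*o cst 1); last first.
  by apply/funext => x /=; rewrite mulr1.
rewrite dot2Zr//; last exact: L2_cst.
rewrite dot2C dot2_cst1_divergence ?mulr0//.
exact: L2_cst.
Qed.

Lemma dot2Nr f g : L2 Omega f -> L2 Omega g ->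
  dot2 Omega f (\- g) = - dot2 Omega f g.
Proof.
move=> f2 g2; rewrite -mulN1r -dot2Zr//; congr dot2.
by apply/funext => x /=; rewrite mulN1r.
Qed.

(** The minus sign in [gradE] is absorbed by replacing u with -u, which preserves the admissible
    fields and their seminorms; constants are orthogonal to divergences. *)
Lemma normm1_grad f : L2 Omega f ->
  normm1 Omega (grad Omega f) = sup_divergence (f \- cst (avg Omega f)).
Proof.
move=> f2; have f02 : L2 Omega (f \- cst (avg Omega f)).
  by apply: L2B => //; exact: L2_cst.
congr ereal_sup; apply/seteqP.
split=> _ [u [uH u0] <-]; have NuH := H10vN mO uH; have Nu0 := nonzerovN u0;
  have uL := L2_divergence mO uH; exists (- u) => //;
  rewrite seminorm1vN gradE// divergenceN; congr ((_ / _)%:E).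
  by rewrite dot2C dot2Nr// -dot2_sub_avg.
by rewrite dot2Nr// opprK dot2_sub_avg// dot2C.
Qed.

Lemma L2_Rintegral f : L2 Omega f -> mu.-integrable Omega (EFin \o f).
Proof.
move=> f2; apply: eq_integrable (L2_integrableM mO f2 (L2_cst 1)) => // x _ /=.
by rewrite mulr1.
Qed.

Hypothesis mu_gt0 : (0 < mu Omega)%E.

Lemma fine_mu_gt0 : 0 < fine (mu Omega).
Proof.
rewrite fine_gt0// mu_gt0/=; apply: le_lt_trans (lebesgue_box_lty M).
by apply: le_measure; rewrite ?inE//; exact: measurable_box.
Qed.

Lemma avg_cst c : avg Omega (cst c) = c.
Proof.
by rewrite /avg Rintegral_cst// mulrCA mulVf ?mulr1// gt_eqF// fine_mu_gt0.
Qed.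

Lemma avgB f g : L2 Omega f -> L2 Omega g ->
  avg Omega (f \- g) = avg Omega f - avg Omega g.
Proof.
by move=> f2 g2; rewrite /avg RintegralB ?mulrBr//; exact: L2_Rintegral.
Qed.

Lemma ae_eq_avg f g : L2 Omega f -> L2 Omega g ->
  f = g %[ae mu in Omega] -> avg Omega f = avg Omega g.
Proof.
move=> f2 g2 fg; congr (_ * fine _); apply: ae_eq_integral => //.
- by have /integrableP[] := L2_Rintegral f2.
- by have /integrableP[] := L2_Rintegral g2.
by apply: filterS fg => x /= fg Ox; rewrite fg.
Qed.

Lemma L20_sub_avg f : L2 Omega f -> L20 Omega (f \- cst (avg Omega f)).
Proof.
move=> f2; have c2 := L2_cst (avg Omega f).
by split; [exact: L2B|rewrite avgB// avg_cst subrr].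
Qed.

(** Reindexes by f - avg f, which is nonzero when f is not constant. Conversely a nonzero g of zero
    average is not constant, because a constant equals its own average. *)
Lemma C_NL0E : C_NL0 Omega =
  ereal_sup [set ((norm2 Omega g)%:E / sup_divergence g)%E | g in
    L20 Omega `&` [set g | ~ (g = cst 0 %[ae mu in Omega])]].
Proof.
congr ereal_sup; apply/seteqP; split=> [_ [f [f2 fc] <-]|_ [g [[g2 g0] gn0] <-]].
  exists (f \- cst (avg Omega f)); last by rewrite normm1_grad.
  split; [exact: L20_sub_avg|move=> f0; apply: fc; exists (avg Omega f)].
  by apply: filterS f0 => x /= H Ox; apply/eqP; rewrite -subr_eq0; apply/eqP/H.
have gE : g \- cst (avg Omega g) = g.
  by apply/funext => x /=; rewrite g0 subr0.
exists g; last by rewrite normm1_grad// gE.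
split=> // -[c gc]; apply: gn0; have := ae_eq_avg g2 (L2_cst c) gc.
by rewrite g0 avg_cst => c0; rewrite [in X in _ = X %[ae _ in _]]c0.
Qed.

Variable C : R.
Hypothesis C_gt0 : 0 < C.
Hypothesis right_inverse_divergence : forall f, L20 Omega f ->
  exists u : 'I_n -> @jet R n,
    [/\ H10v Omega u, divergence u = f %[ae mu in Omega] &
        seminorm1v Omega u <= C * norm2 Omega f].

Lemma sup_divergence_ge g : L20 Omega g -> ~ (g = cst 0 %[ae mu in Omega]) ->
  ((norm2 Omega g / C)%:E <= sup_divergence g)%E.
Proof.
move=> Lg gn0; have [g2 _] := Lg; have [u [uH ug uC]] := right_inverse_divergence Lg.
have uL := L2_divergence mO uH.
have g_gt0 : 0 < norm2 Omega g.
  rewrite lt_neqAle norm2_ge0 andbT eq_sym; apply/eqP => /(norm2_eq0 mO g2).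
  exact: gn0.
have un0 : nonzerov Omega u.
  apply: nonzerov_divergence => // u0; apply: gn0.
  by apply: filterS2 ug u0 => x /= H1 H2 Ox; rewrite -H1// H2.
have ugg : dot2 Omega (divergence u) g = norm2 Omega g ^+ 2.
  by rewrite dot2C norm2E; exact: ae_eq_dot2r.
(* If the seminorm vanished, continuity of the pairing would force $\|g\|^2 \le 0$. *)
have u_gt0 : 0 < seminorm1v Omega u.
  rewrite lt_neqAle seminorm1v_ge0 andbT; apply/eqP => u0.
  have := dot2_divergence_le mO g2 uH.
  rewrite -u0 mulr0 dot2C ugg ger0_norm ?sqr_ge0// leNgt.
  by rewrite exprn_gt0.
apply: (@le_trans _ _ (dot2 Omega (divergence u) g / seminorm1v Omega u)%:E).
  rewrite lee_fin ugg ler_pdivlMr// mulrAC ler_pdivrMr//.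
  by rewrite expr2 -mulrA ler_pM2l// mulrC.
by apply: ereal_sup_ubound; exists u.
Qed.

Lemma beta0E : beta0 Omega = ereal_inf
  [set ((norm2 Omega g)^-1%:E * sup_divergence g)%E | g in
    L20 Omega `&` [set g | ~ (g = cst 0 %[ae mu in Omega])]].
Proof.
rewrite /beta0; congr ereal_inf; apply/eq_imagel => g [Lg gn0].
rewrite /sup_divergence -ereal_supZl ?invr_ge0 ?norm2_ge0//.
  rewrite image_comp; congr ereal_sup; apply: eq_imagel => u _ /=.
  by rewrite -EFinM invfM [_^-1 * _^-1]mulrC mulrCA.
(* Pulling the scalar out of the supremum requires a nonempty index set; a field with divergence g
   is a member. *)
have [g2 _] := Lg; have [u [uH ug _]] := right_inverse_divergence Lg.
apply/set0P; eexists; exists u; last reflexivity.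
split => //; apply: nonzerov_divergence => // u0; apply: gn0.
by apply: filterS2 ug u0 => x /= H1 H2 Ox; rewrite -H1// H2.
Qed.

Lemma C_NL0_beta0 : (exists2 f, L2 Omega f &
    ~ exists c : R, f = cst c %[ae mu in Omega]) ->
  (C_NL0 Omega <= C%:E)%E /\ C_NL0 Omega = (beta0 Omega)^-1%E.
Proof.
move=> [f f2 fc]; rewrite C_NL0E beta0E.
set G := L20 Omega `&` _.
have G_gt0 g : G g -> 0 < norm2 Omega g.
  move=> [[g2 _] gn0]; rewrite lt_neqAle norm2_ge0 andbT eq_sym.
  by apply/eqP => /(norm2_eq0 mO g2).
have G_ge g : G g -> ((norm2 Omega g / C)%:E <= sup_divergence g)%E.
  by move=> [Lg gn0]; exact: sup_divergence_ge.
have G_sup g : G g -> (0 < sup_divergence g)%E.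
  by move=> Gg; rewrite (lt_le_trans _ (G_ge _ Gg))// lte_fin divr_gt0// G_gt0.
split.
  apply: ge_ereal_sup => _ [g Gg <-]; have g_gt0 := G_gt0 _ Gg.
  have gC_gt0 : 0 < norm2 Omega g / C by rewrite divr_gt0.
  have : ((sup_divergence g)^-1 <= (norm2 Omega g / C)%:E^-1)%E.
    have s_ge0 := ltW (G_sup _ Gg).
    rewrite inve_pge.
    - by rewrite inveK; exact: G_ge.
    - by rewrite inE/= inve_ge0.
    - by rewrite inE/= lee_fin ltW.
  rewrite inver gt_eqF// invf_div => H.
  apply: le_trans (lee_wpmul2l _ H) _; first by rewrite lee_fin ltW.
  by rewrite -EFinM lee_fin mulrCA mulfV ?mulr1// gt_eqF.
rewrite -ereal_sup_inve.
- rewrite image_comp; congr ereal_sup; apply: eq_imagel => g Gg /=.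
  have g_gt0 := G_gt0 _ Gg; have s_gt0 := G_sup _ Gg.
  (* The inverse of the product splits because one factor is a positive real and the other is
     positive, which excludes 0 * +oo. *)
  rewrite inveM; first by rewrite inver gt_eqF ?invr_gt0// invrK.
  by rewrite inveM_defE (gt_eqF s_gt0) eqe gt_eqF ?invr_gt0//= lte_fin invr_gt0 g_gt0 implybT.
(* The index set is nonempty: a nonconstant f minus its average belongs to it. *)
- eexists; exists (f \- cst (avg Omega f)); last reflexivity.
  split; first exact: L20_sub_avg.
  move=> f0; apply: fc; exists (avg Omega f).
  by apply: filterS f0 => x /= H Ox; apply/eqP; rewrite -subr_eq0; apply/eqP/H.
move=> _ [g Gg <-]; rewrite mule_ge0 ?lee_fin ?invr_ge0 ?norm2_ge0//.
exact/ltW/G_sup.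
Qed.

End bounded_domain.

(** * Existence of a nonconstant square-integrable function *)

Section half_boxes.
Context {R : realType} {n : nat}.
Local Notation E := 'rV[R]_n.
Local Notation mu := (@lebesgue_rV R n).

(** A cube around x0 inside Omega is cut by the hyperplane through x0 orthogonal to direction k;
    each open half is a box with sides of positive length. *)
Lemma open_half_boxes (Omega : set E) x0 (k : 'I_n) : open Omega -> Omega x0 ->
  exists A B : set E, [/\ measurable A, measurable B,
    A `<=` Omega `&` [set x | x0 ord0 k < x ord0 k],
    B `<=` Omega `&` [set x | ~ x0 ord0 k < x ord0 k] &
    ((0 < mu A) /\ (0 < mu B))%E].
Proof.
move=> oO Ox0; have /nbhs_ballP[e /= e0 eO] := open_nbhs_nbhs (conj oO Ox0).
pose I (l r : R) (j : 'I_n) : set (measurableTypeR R) :=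
  if j == k then `]x0 ord0 j + l, x0 ord0 j + r[%classic
  else `]x0 ord0 j - e, x0 ord0 j + e[%classic.
have mI l r j : measurable (I l r j) by rewrite /I; case: ifP.
have IO l r : - e <= l -> r <= e ->
    [set x : E | forall j, I l r j (x ord0 j)] `<=` Omega.
  move=> le re x Ix; apply: eO; split=> // i j; rewrite (ord1 i) /ball/= ltr_distlC.
  have := Ix j; rewrite /I; case: ifP => _; rewrite /= in_itv/= => /andP[xl xr]//.
  by apply/andP; split; [apply: le_lt_trans xl|apply: lt_le_trans xr _]; rewrite lerD2l.
have Ik l r (x : E) : (forall j, I l r j (x ord0 j)) ->
    x0 ord0 k + l < x ord0 k < x0 ord0 k + r.
  by move=> /(_ k); rewrite /I eqxx /= in_itv.
have I0 l r : l < r -> (0 < mu [set x : E | forall j, I l r j (x ord0 j)])%E.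
  move=> lr; rewrite lebesgue_rV_box//.
  elim/big_ind: _ => [|x y|j _]; [exact: lte01|exact: mule_gt0|].
  rewrite /I; case: ifP => _; rewrite lebesgue_measure_itv/= lte_fin ?ltrD2l ?lr.
    by rewrite -EFinB lte_fin subr_gt0 ltrD2l.
  by rewrite gtrN// -EFinB lte_fin subr_gt0 ltrD2l gtrN.
exists [set x | forall j, I 0 e j (x ord0 j)], [set x | forall j, I (- e) 0 j (x ord0 j)].
split.
- exact: measurable_rV_box.
- exact: measurable_rV_box.
- move=> x Ix; split; first by apply: IO Ix => //; rewrite oppr_le0 ltW.
  by have := Ik _ _ _ Ix; rewrite addr0 => /andP[].
- move=> x Ix; split; first by apply: IO Ix => //; exact: ltW.
  by have := Ik _ _ _ Ix; rewrite addr0 /= => /andP[_ xk]; apply/negP; rewrite -leNgt ltW.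
- by split; apply: I0 => //; rewrite oppr_lt0.
Qed.

(* Without a nonconstant function in L^2, C_NL0 would be sup set0 = -oo while
   beta0^-1 = (+oo)^-1 = 0. *)
Lemma half_space_nonconstant (Omega : set E) (k : 'I_n) (c0 : R) (A B : set E) :
  measurable A -> measurable B ->
  A `<=` Omega `&` [set x | c0 < x ord0 k] ->
  B `<=` Omega `&` [set x | ~ c0 < x ord0 k] -> (0 < mu A)%E -> (0 < mu B)%E ->
  ~ exists c : R, \1_[set x : E | c0 < x ord0 k] = cst c %[ae mu in Omega].
Proof.
move=> mA mB AO BO A0 B0 [c H]; have [c1|c1] := eqVneq c 1.
  suff : mu B = 0%E by move=> BE; rewrite BE ltxx in B0.
  apply: measure_negligible => //; apply: negligibleS H => x /BO[Ox xk] /= /(_ Ox).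
  by rewrite indicE memNset// c1 => /esym/eqP; rewrite oner_eq0.
suff : mu A = 0%E by move=> AE; rewrite AE ltxx in A0.
apply: measure_negligible => //; apply: negligibleS H => x /AO[Ox xk] /= /(_ Ox).
by rewrite indicE mem_set// => /esym/eqP; rewrite (negbTE c1).
Qed.

End half_boxes.

Theorem proposition1p1 (R : realType) (n : nat) (n2 : (2 <= n)%N)
    (Omega : set 'rV[R]_n) (diam rho : R)
    (Omega_domain : is_domain Omega)
    (Omega_diam : diameter Omega = diam%:E)
    (rho0 : 0 < rho)
    (Omega_star : exists c : 'rV[R]_n, star_shaped Omega (eball c rho))
    (C_BA0 : R) (C_BA0_gt0 : 0 < C_BA0)
    (C_BA0P : forall f : 'rV[R]_n -> R, L20 Omega f ->
       exists u : 'I_n -> @jet R n,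
         [/\ H10v Omega u,
             divergence u = f %[ae (@lebesgue_rV R n) in Omega] &
             seminorm1v Omega u <= C_BA0 * norm2 Omega f]) :
  (C_NL0 Omega <= C_BA0%:E)%E /\ C_NL0 Omega = (beta0 Omega)^-1%E.
Proof.
have [[x0 Ox0] oO _] := Omega_domain.
have mO := open_measurable_rV oO.
have OM := diameter_box Ox0 Omega_diam.
pose k : 'I_n := Ordinal (ltnW n2).
have [A [B [mA mB AO BO [A0 B0]]]] := open_half_boxes k oO Ox0.
have O0 : (0 < lebesgue_rV Omega)%E.
  apply: lt_le_trans A0 _; apply: le_measure; rewrite ?inE//.
  by move=> x /AO[].
apply: (C_NL0_beta0 mO OM O0 C_BA0_gt0 C_BA0P).
(* The indicator of a half space bounded by a hyperplane through x0: it is bounded, hence in [L2] of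
   a subset of a box, and takes both values on sets of positive measure. *)
exists (\1_[set x : 'rV[R]_n | x0 ord0 k < x ord0 k]).
  have mH : measurable [set x : 'rV[R]_n | x0 ord0 k < x ord0 k].
    rewrite (_ : [set _ | _] = rV_coord k @^-1` `]x0 ord0 k, +oo[%classic).
      by rewrite -[X in measurable X]setTI; apply: measurable_rV_coord.
    by apply/seteqP; split=> x; rewrite /= in_itv/= andbT.
  apply: (L2_bounded (C := 1) mO OM); first exact: measurable_indic.
  by move=> x; rewrite indicE; case: (_ \in _); rewrite ?normr1 ?normr0.
exact: half_space_nonconstant AO BO A0 B0.
Qed.
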